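(* Let $\mathbb{K}$ be a field of characteristic zero and let $G_1,G_2$ be finite undirected graphs without loops (multiple edges allowed). Then the algebras $\mathcal{B}^F_{G_1}$ and $\mathcal{B}^F_{G_2}$ are isomorphic if and only if the graphical matroids of $G_1$ and $G_2$ are isomorphic. This holds both when ''isomorphic'' for algebras means isomorphic as graded $\mathbb{K}$-algebras and when it means isomorphic as (non-graded) $\mathbb{K}$-algebras.
   Context: For a graph $G$ with vertex set $\{1,\dots,n\}$, let $J^F_G\subset \mathbb{K}[x_1,\dots,x_n]$ be the ideal generated by the polynomials $\left(\sum_{i\in I}x_i\right)^{D_I+1}$, where $I$ ranges over all nonempty subsets of vertices and $D_I$ is the number of edges of $G$ joining a vertex of $I$ to a vertex outside $I$. Define $\mathcal{B}^F_G=\mathbb{K}[x_1,\dots,x_n]/J^F_G$, graded by degree. The graphical matroid of $G$ is the matroid on $E(G)$ whose independent sets are the edge sets of forests (acyclic subgraphs) of $G$. *)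

(* Defs.v *)
From HB Require Import structures.
From mathcomp Require Import all_boot all_order all_algebra.
From mathcomp Require Import ring_quotient boolp.
From mathcomp Require Import mpoly.

Set Implicit Arguments.
Unset Strict Implicit.
Unset Printing Implicit Defensive.

Import GRing.Theory.

(* Each edge carries its two-element set of endpoints: loops are excluded,
   parallel edges are not. *)
Record multigraph := Multigraph {
  nvertices : nat;
  edge : finType;
  ends : edge -> {set 'I_nvertices};
  card_ends : forall e, #|ends e| = 2
}.

Record matroid := Matroid {
  ground : finType;
  indep : {set ground} -> Prop;
  indep0 : indep set0;
  indepS : forall A B : {set ground}, A \subset B -> indep B -> indep A;
  indep_aug : forall A B : {set ground}, indep A -> indep B -> #|A| < #|B| ->
    exists2 e, e \in B :\: A & indep (e |: A)
}.

Definition matroid_isomorphic (M N : matroid) : Prop :=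
  exists2 f : ground M -> ground N, bijective f &
    forall A : {set ground M}, indep A <-> indep (f @: A).

Section GraphicalMatroid.
Variable G : multigraph.
Implicit Types (A B : {set edge G}) (e f : edge G) (u v w x y : 'I_(nvertices G)).

(* A cycle is the cyclic list (v_0, e_0), ..., (v_(k-1), e_(k-1)) where e_i
   joins v_i to v_(i+1), with the vertices distinct and the edges distinct. *)
Definition step (p q : 'I_(nvertices G) * edge G) : bool :=
  ends p.2 == [set p.1; q.1].

Definition is_cycle (c : seq ('I_(nvertices G) * edge G)) : bool :=
  [&& c != [::], uniq (unzip1 c), uniq (unzip2 c) & cycle step c].

Definition forest A : Prop :=
  forall c, is_cycle c -> ~ {subset unzip2 c <= A}.

Definition adj A u v : bool := [exists e in A, ends e == [set u; v]].

Lemma adj_sym A : ssrbool.symmetric (adj A).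
Proof. by move=> u v; apply: eq_existsb => e; rewrite setUC. Qed.

Lemma ends_neq e u v : ends e = [set u; v] -> u != v.
Proof. by move=> E; have := card_ends e; rewrite E cards2; case: eqP. Qed.

Lemma endsP e : exists u v, ends e = [set u; v].
Proof.
have /eqP/cards2P[u [v [_ ->]]] := card_ends e.
by exists u, v.
Qed.

Lemma forest0 : forest set0.
Proof.
by move=> [//|p c] _ /(_ p.2); rewrite /= !inE eqxx => /(_ isT).
Qed.

Lemma forestS A B : A \subset B -> forest B -> forest A.
Proof. by move=> /subsetP sAB fB c /fB nc sc; apply: nc => e /sc /sAB. Qed.

Lemma step_connect A p c :
    path step p c -> {subset belast p.2 (unzip2 c) <= A} ->
  connect (adj A) p.1 (last p c).1.
Proof.
elim: c p => [//|q c IHc] p /= /andP[pq qc] sA.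
apply: (@connect_trans _ _ q.1).
  by apply/connect1/existsP; exists p.2; rewrite -/(step p q) pq sA ?mem_head.
by apply: IHc qc _ => e ec; rewrite sA // inE ec orbT.
Qed.

Lemma forestU1 A e u v : forest A -> ends e = [set u; v] ->
  ~~ connect (adj A) u v -> forest (e |: A).
Proof.
move=> fA euv /negP nc c /and4P[c0 U1 U2 cc] sc.
have [ec|nec] := boolP (e \in unzip2 c); last first.
  apply: (fA c); first by rewrite /is_cycle c0 U1 U2 cc.
  by move=> f fc; move: (sc f fc) nec; rewrite !inE => /orP[/eqP <-|//]; rewrite fc.
have /mapP[[w e'] wc /= ee'] := ec; rewrite -{e'}ee' in wc.
have [i c' rc] := rot_to wc.
have {}cc : cycle step ((w, e) :: c') by rewrite -rc rot_cycle.
have {}U2 : uniq (unzip2 ((w, e) :: c')) by rewrite -rc /unzip2 map_rot rot_uniq.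
have {}sc : {subset unzip2 ((w, e) :: c') <= e |: A}.
  by move=> f; rewrite -rc /unzip2 map_rot mem_rot; apply: sc.
have symc : connect_sym (adj A) by apply: sym_connect_sym; apply: adj_sym.
case: c' cc U2 sc {rc} => [|q c'].
  by rewrite /= andbT => /eqP /= /ends_neq; rewrite eqxx.
rewrite /cycle rcons_cons [path _ _ _]/= => /andP[/eqP /= eq1 cc] /andP[ne U] sc.
suff: connect (adj A) q.1 w.
  move: (eq1); rewrite euv => E.
  have: u \in [set w; q.1] by rewrite -E !inE eqxx.
  have: v \in [set w; q.1] by rewrite -E !inE eqxx orbT.
  have neuv := ends_neq euv.
  rewrite !inE => /orP[]/eqP vE /orP[]/eqP uE.
  - by rewrite uE vE eqxx in neuv.
  - by rewrite -uE -vE.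
  - by rewrite symc -uE -vE.
  - by rewrite uE vE eqxx in neuv.
have := @step_connect A q (rcons c' (w, e)) cc.
rewrite last_rcons /=; apply=> f.
rewrite /unzip2 map_rcons belast_rcons => fc.
have := sc f; rewrite inE fc orbT !inE => /(_ isT) /orP[/eqP fe|//].
by rewrite -fe fc in ne.
Qed.

Lemma path_step A x p : path (adj A) x p -> uniq (x :: p) ->
  exists c : seq ('I_(nvertices G) * edge G),
  [/\ unzip1 c = belast x p, {subset unzip2 c <= A}, uniq (unzip2 c),
      forall e, e \in unzip2 c -> {subset ends e <= x :: p}
    & forall q, q.1 = last x p -> sorted step (rcons c q)].
Proof.
elim: p x => [|y p IHp] x; first by exists [::].
rewrite [path _ _ _]/= [uniq _]/=.
move=> /andP[/existsP[e /andP[eA /eqP exy]] yp] /andP[xp Uyp].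
have [c [c1 c2 cU cS cP]] := IHp y yp Uyp.
exists ((x, e) :: c); split=> /=.
- by rewrite c1.
- by move=> f; rewrite inE => /orP[/eqP->|/c2].
- rewrite cU andbT; apply: contra xp => /cS; apply.
  by rewrite exy !inE eqxx.
- move=> f; rewrite inE => /orP[/eqP->|/cS s] z.
    by rewrite exy !inE => /orP[]->; rewrite ?orbT.
  by rewrite inE => /s ->; rewrite orbT.
- move=> q qE; have := cP q qE.
  case: c c1 {c2 cU cS cP} => [|r c] /=.
    by case: p qE {IHp yp Uyp xp} => //= qE _ _; rewrite /step exy qE eqxx.
  case: p {IHp yp Uyp xp qE} => //= z p [r1 _] ->.
  by rewrite /step exy r1 eqxx.
Qed.

Lemma forest_bridge B e u v : forest B -> e \in B -> ends e = [set u; v] ->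
  ~~ connect (adj (B :\ e)) u v.
Proof.
move=> fB eB euv; apply/negP => /connectP[p0 p0P vE].
case: (shortenP p0P) vE => p pP Up _ vE {p0 p0P}.
have [c [c1 c2 cU cS cP]] := path_step pP Up.
have neuv := ends_neq euv.
apply: (fB (rcons c (v, e))).
  rewrite /is_cycle /unzip1 /unzip2 !map_rcons -/(unzip1 c) -/(unzip2 c).
  rewrite c1 /= vE -lastI Up rcons_uniq cU andbT -vE.
  rewrite -size_eq0 size_rcons /=; apply/andP; split.
    by apply/negP => /c2; rewrite !inE eqxx.
  case: c c1 {c2 cU cS} cP => [|r c] c1 cP /=.
    by case: p c1 vE {pP Up cP} => //= _ vE; rewrite vE eqxx in neuv.
  have ru : r.1 = u by case: p c1 {vE pP Up cP} => //= y p [].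
  have /= cve := cP (v, e) vE.
  by rewrite rcons_path last_rcons cve /step /= euv ru setUC eqxx.
move=> f; rewrite /unzip2 map_rcons mem_rcons inE => /orP[/eqP->//|/c2].
by rewrite !inE => /andP[].
Qed.

Lemma connect_leave A (P : rel 'I_(nvertices G)) u v :
    reflexive P -> transitive P -> connect (adj A) u v -> ~~ P u v ->
  exists2 f, f \in A & exists x y, ends f = [set x; y] /\ ~~ P x y.
Proof.
move=> Pr Pt /connectP[p pP ->]; elim: p u pP => [|y p IHp] u /=.
  by rewrite Pr.
case/andP=> /existsP[f /andP[fA /eqP fE]] yp nP.
have [Puy|nPuy] := boolP (P u y); last by exists f => //; exists u, y.
by apply: IHp yp _; apply: contra nP; apply: Pt.
Qed.

Lemma forest_le A B : forest A -> forest B ->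
    (forall e u v, e \in B -> ends e = [set u; v] -> connect (adj A) u v) ->
  #|B| <= #|A|.
Proof.
move=> fA; move: {2}_.+1 (ltnSn #|B :\: A|) => k.
elim: k B => // k IHk B ltk fB sB.
have [sBA|/subsetPn[e eB eA]] := boolP (B \subset A).
  exact: subset_leq_card.
have [u [v euv]] := endsP e.
have br := forest_bridge fB eB euv.
have [f fA' [x [y [fxy nxy]]]] :
    exists2 f, f \in A &
    exists x y, ends f = [set x; y] /\ ~~ connect (adj (B :\ e)) x y.
  apply: connect_leave br; [exact: connect0 | | exact: sB euv].
  by move=> y x z; apply: connect_trans.
have nfB : f \notin B :\ e.
  apply: contra nxy => fBe; apply/connect1/existsP; exists f.
  by rewrite fBe fxy eqxx.
have -> : #|B| = #|f |: (B :\ e)|.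
  by rewrite cardsU1 nfB (cardsD1 e B) eB.
apply: IHk.
- have -> : (f |: (B :\ e)) :\: A = (B :\: A) :\ e.
    apply/setP=> z; rewrite !inE; case: eqP => [->|_] /=; first by rewrite fA' /= andbF.
    by rewrite andbCA.
  by move: ltk; rewrite (cardsD1 e (B :\: A)) !inE eA eB.
- by apply: forestU1 fxy nxy; apply: forestS fB; apply: subsetDl.
- move=> g x' y'; rewrite !inE => /orP[/eqP->|/andP[_ gB]] gE; last exact: sB gE.
  by apply/connect1/existsP; exists f; rewrite fA' gE eqxx.
Qed.

Lemma forest_aug A B : forest A -> forest B -> #|A| < #|B| ->
  exists2 e, e \in B :\: A & forest (e |: A).
Proof.
move=> fA fB ltAB; apply: contrapT => nex.
move: ltAB; rewrite ltnNge => /negP; apply; apply: (forest_le fA fB).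
move=> e u v eB euv; apply: contrapT => /negP nc; apply: nex.
exists e; last exact: forestU1 fA euv nc.
rewrite inE eB andbT; apply: contra nc => eA.
by apply/connect1/existsP; exists e; rewrite eA euv eqxx.
Qed.

Definition graphical_matroid : matroid :=
  Matroid forest0 forestS forest_aug.

End GraphicalMatroid.

Local Open Scope ring_scope.

Section Algebra.
Variables (K : fieldType) (G : multigraph).
Local Notation n := (nvertices G).

Definition cut_size (I : {set 'I_n}) : nat :=
  #|[set e : edge G | [exists u in I, exists v in ~: I, ends e == [set u; v]]]|.

Definition JF_gen (I : {set 'I_n}) : {mpoly K[n]} :=
  (\sum_(i in I) 'X_i) ^+ (cut_size I).+1.

(* Membership in the ideal generated by the JF_gen I; it is made boolean
   classically because quotients are taken by boolean predicates. *)
Definition JF (p : {mpoly K[n]}) : bool :=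
  `[< exists c : {set 'I_n} -> {mpoly K[n]},
        p = \sum_(I : {set 'I_n} | I != set0) c I * JF_gen I >].

Lemma JF_idealr_closed : idealr_closed JF.
Proof.
split.
- apply/asboolP; exists (fun=> 0).
  by rewrite big1 // => I _; rewrite mul0r.
- apply/negP => /asboolP[c /(congr1 (meval (fun=> 0)))].
  rewrite rmorph1 rmorph_sum big1 => [/eqP|I _]; first by rewrite oner_eq0.
  rewrite rmorphM rmorphXn rmorph_sum /= [X in X ^+ _]big1 => [|i _].
    by rewrite expr0n mulr0.
  by rewrite mevalXU.
- move=> a p q /asboolP[c ->] /asboolP[d ->]; apply/asboolP.
  exists (fun I => a * c I + d I).
  rewrite mulr_sumr -big_split; apply: eq_bigr => I _ /=.
  by rewrite mulrDl mulrA.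
Qed.

HB.instance Definition _ :=
  isIdealr.Build {mpoly K[n]} JF JF_idealr_closed.

Definition JF_ideal : idealr {mpoly K[n]} := JF.

Definition BF := {ideal_quot JF_ideal}.

HB.instance Definition _ := GRing.ComNzRing.on BF.

Definition BF_pi (p : {mpoly K[n]}) : BF := (\pi_{ideal_quot JF_ideal} p)%qT.

Lemma BF_piD : {morph BF_pi : p q / p + q}.
Proof. by move=> p q; rewrite /BF_pi raddfD. Qed.

Lemma BF_piM : {morph BF_pi : p q / p * q}.
Proof. by move=> p q; rewrite /BF_pi rmorphM. Qed.

Lemma BF_pi1 : BF_pi 1 = 1.
Proof. by rewrite /BF_pi rmorph1. Qed.

Lemma BF_piP (x : BF) : exists p, x = BF_pi p.
Proof. by exists (repr x); rewrite /BF_pi reprK. Qed.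

Definition BF_scale (a : K) (x : BF) : BF := BF_pi a%:MP * x.

Lemma BF_scaleA a b x : BF_scale a (BF_scale b x) = BF_scale (a * b) x.
Proof. by rewrite /BF_scale mulrA -BF_piM -mpolyCM. Qed.

Lemma BF_scale1 : left_id 1 BF_scale.
Proof. by move=> x; rewrite /BF_scale mpolyC1 BF_pi1 mul1r. Qed.

Lemma BF_scaleDr : right_distributive BF_scale +%R.
Proof. by move=> a x y; rewrite /BF_scale mulrDr. Qed.

Lemma BF_scaleDl x : {morph BF_scale^~ x : a b / a + b}.
Proof. by move=> a b; rewrite /BF_scale mpolyCD BF_piD mulrDl. Qed.

HB.instance Definition _ := GRing.Zmodule_isLmodule.Build K BF
  BF_scaleA BF_scale1 BF_scaleDr BF_scaleDl.

Lemma BF_scaleAl (a : K) (x y : BF) : a *: (x * y) = a *: x * y.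
Proof. exact: mulrA. Qed.

HB.instance Definition _ := GRing.Lmodule_isLalgebra.Build K BF BF_scaleAl.
HB.instance Definition _ := GRing.Lalgebra_isComAlgebra.Build K BF.

(* The degree d component of BF is the image of the forms of degree d. *)
Definition BF_homog (d : nat) (x : BF) : Prop :=
  exists2 p : {mpoly K[n]}, p \is d.-homog & x = BF_pi p.

End Algebra.

Definition BF_isomorphic (K : fieldType) (G1 G2 : multigraph) : Prop :=
  exists f : {lrmorphism BF K G1 -> BF K G2}, bijective f.

Definition BF_graded_isomorphic (K : fieldType) (G1 G2 : multigraph) : Prop :=
  exists2 f : {lrmorphism BF K G1 -> BF K G2}, bijective f &
    forall d x, BF_homog d x <-> BF_homog d (f x).

(* Main.v *)
From HB Require Import structures.
Require Import Defs.
From mathcomp Require Import all_boot all_order all_algebra.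
From mathcomp Require Import ring_quotient boolp.
From mathcomp Require Import mpoly ring zify.

Set Implicit Arguments.
Unset Strict Implicit.
Unset Printing Implicit Defensive.

Import GRing.Theory.
Local Open Scope ring_scope.

(** A polynomial [p] lies in the ideal iff, for every set [S] of edges, the
    iterated derivative of [p] along the vectors [e_i - e_j], [ij] in [S],
    vanishes at the origin.  This is proved by induction on the number of edges:
    if [p] satisfies the condition for [G], then its derivative along an edge
    [uw] satisfies it for [G - uw], hence lies in the ideal of [G - uw], and has
    an antiderivative in the ideal of [G]; what remains is constant along
    [e_u - e_w], i.e. a polynomial on the contraction [G / uw].

    So the algebra depends only on the configuration of the edge vectors up to
    linear isomorphism and rescaling.  A matroid isomorphism matches two such
    configurations up to signs, by the unique representability of regular
    matroids.  Conversely, in the algebra the nilpotency index of a linear form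
    exceeds by one the number of edges on which it does not vanish, and any
    algebra isomorphism induces on the cotangent spaces a linear map preserving
    these numbers; by MacWilliams' argument such a map matches the edge
    functionals up to scalars, and forests are the independent sets of edge
    functionals. *)

(** * Derivatives along a vector *)

Lemma mpoly_alg_ind (R : comNzRingType) n (P : {mpoly R[n]} -> Prop) :
    (forall c, P c%:MP) -> (forall i, P 'X_i) ->
    (forall p q, P p -> P q -> P (p + q)) ->
    (forall p q, P p -> P q -> P (p * q)) ->
  forall p, P p.
Proof.
move=> PC PX PD PM; elim/mpolyind => [|c m p _ _ IHp]; first by rewrite -mpolyC0.
apply: PD => //; rewrite -mul_mpolyC mpolyXE_id; apply: (PM) => //.
have P1 : P 1 by rewrite -mpolyC1.
apply: big_ind => [//|x y|i _]; first exact: (PM).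
by elim: (m i) => [//|k IHk]; rewrite exprS; apply: (PM).
Qed.

Section DirectionalDerivative.
Variables (K : fieldType) (n : nat).
Implicit Types (p q : {mpoly K[n]}) (v w : 'rV[K]_n).

Definition ddir v p : {mpoly K[n]} := \sum_i v 0 i *: p^`M(i).

Fact ddir_is_linear v : linear (ddir v).
Proof.
move=> a p q; rewrite /ddir scaler_sumr -big_split; apply: eq_bigr => i _ /=.
by rewrite mderivD mderivZ scalerDr !scalerA mulrC.
Qed.

HB.instance Definition _ v :=
  GRing.isLinear.Build K {mpoly K[n]} {mpoly K[n]} _ (ddir v)
    (ddir_is_linear v).

Lemma ddirC v c : ddir v c%:MP = 0.
Proof. by rewrite /ddir big1 // => i _; rewrite mderivC scaler0. Qed.

Lemma ddirM v p q : ddir v (p * q) = ddir v p * q + p * ddir v q.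
Proof.
rewrite /ddir mulr_suml mulr_sumr -big_split; apply: eq_bigr => i _ /=.
by rewrite mderivM scalerDr scalerAl scalerAr.
Qed.

Lemma ddirX v i : ddir v 'X_i = (v 0 i)%:MP.
Proof.
rewrite /ddir (bigD1 i) //= big1 => [|j ji]; last first.
  by rewrite mderivX mnm1E eq_sym (negPf ji) scale0r scaler0.
have U0 : (U_(i) - U_(i))%MM = 0%MM by apply/mnmP => j; rewrite mnmBE mnm0E subnn.
by rewrite mderivX mnm1E eqxx scale1r U0 mpolyX0 addr0 alg_mpolyC.
Qed.

Lemma ddirXn v p k : ddir v (p ^+ k) = (p ^+ k.-1 * ddir v p) *+ k.
Proof.
elim: k => [|k IHk]; first by rewrite expr0 mulr0n -mpolyC1 ddirC.
rewrite exprS ddirM IHk; case: k {IHk} => [|k] /=.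
  by rewrite !expr0 mulr0n mulr0 addr0 mulr1 mul1r mulr1n.
by rewrite mulrnAr [X in _ + X *+ _]mulrA -exprS mulrC [in RHS]mulrS.
Qed.

Lemma ddir_comm v w p : ddir v (ddir w p) = ddir w (ddir v p).
Proof.
rewrite /ddir.
transitivity (\sum_i \sum_j (v 0 i * w 0 j) *: p^`M(j)^`M(i)).
  apply: eq_bigr => i _; rewrite (linear_sum (mderiv i)) scaler_sumr /=.
  by apply: eq_bigr => j _; rewrite mderivZ scalerA.
rewrite exchange_big /=; apply: eq_bigr => j _.
rewrite (linear_sum (mderiv j)) scaler_sumr /=; apply: eq_bigr => i _.
by rewrite mderivZ scalerA mulrC mderiv_comm.
Qed.

Lemma ddir_vecZ a v p : ddir (a *: v) p = a *: ddir v p.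
Proof.
by rewrite /ddir scaler_sumr; apply: eq_bigr => i _; rewrite mxE scalerA.
Qed.

Lemma ddir_vec0 p : ddir 0 p = 0.
Proof. by rewrite -(scale0r 0) ddir_vecZ scale0r. Qed.

Definition at0 p : K := p.@[fun=> 0].

Lemma at0D p q : at0 (p + q) = at0 p + at0 q.
Proof. exact: mevalD. Qed.
Lemma at0B p q : at0 (p - q) = at0 p - at0 q.
Proof. exact: mevalB. Qed.
Lemma at0M p q : at0 (p * q) = at0 p * at0 q.
Proof. exact: mevalM. Qed.
Lemma at0C c : at0 c%:MP = c.
Proof. exact: mevalC. Qed.
Lemma at0Z c p : at0 (c *: p) = c * at0 p.
Proof. exact: mevalZ. Qed.
Lemma at0X i : at0 'X_i = 0.
Proof. exact: mevalXU. Qed.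
Lemma at0Xn p k : at0 (p ^+ k) = at0 p ^+ k.
Proof. exact: rmorphXn. Qed.

Lemma at0_sum (I : finType) (P : pred I) (F : I -> {mpoly K[n]}) :
  at0 (\sum_(i | P i) F i) = \sum_(i | P i) at0 (F i).
Proof. exact: raddf_sum. Qed.

Lemma msize_ddir v p : (msize (ddir v p) <= (msize p).-1)%N.
Proof.
have key q i : (msize (q^`M(i)) <= (msize q).-1)%N.
  rewrite {1}msizeE; apply/bigmax_leqP_seq => m mq _.
  have : (m + U_(i))%MM \in msupp q.
    move: mq; rewrite !mcoeff_msupp mcoeff_mderiv.
    by apply: contra => /eqP ->; rewrite mul0rn.
  by move/msize_mdeg_lt; rewrite mdegD mdeg1 addn1; case: (msize q).
rewrite /ddir; apply: (@big_ind _ (fun q => (msize q <= (msize p).-1)%N)).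
- by rewrite msize0.
- by move=> x y xp yp; apply: leq_trans (msizeD_le _ _) _; rewrite geq_max xp.
- by move=> i _; apply: leq_trans (msizeZ_le _ _) (key p i).
Qed.

(** Each derivative lowers the degree. Nilpotency supports the recursion in [antiderivative] and the
    descent in [merge_id]. *)
Lemma ddir_nilpotent v p : exists k, iter k (ddir v) p = 0.
Proof.
exists (msize p); apply/eqP; rewrite -msize_poly_eq0 -leqn0.
suff: forall k, (msize (iter k (ddir v) p) <= msize p - k)%N.
  by move/(_ (msize p)); rewrite subnn.
elim=> [|k IHk]; first by rewrite subn0.
by rewrite iterS subnS; apply: leq_trans (msize_ddir _ _) _; rewrite -!subn1 leq_sub2r.
Qed.

(* [p] lies in [annih vs] iff [p] vanishes when [x_i] is replaced by
   [\sum_j (vs_j)_i phi_j], the [phi_j] being commuting variables of square 0. *)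
Fixpoint annih (vs : seq 'rV[K]_n) p : Prop :=
  if vs is v :: vs' then annih vs' p /\ annih vs' (ddir v p) else at0 p = 0.

Lemma annih0 vs : annih vs 0.
Proof. by elim: vs => [|v vs IHvs] /=; rewrite ?linear0 // -mpolyC0 at0C. Qed.

Lemma annihD vs p q : annih vs p -> annih vs q -> annih vs (p + q).
Proof.
elim: vs p q => [|v vs IHvs] p q /=; first by rewrite at0D => -> ->; rewrite addr0.
by move=> [p1 p2] [q1 q2]; rewrite linearD; split; apply: IHvs.
Qed.

Lemma annihZ vs a p : annih vs p -> annih vs (a *: p).
Proof.
elim: vs p => [|v vs IHvs] p /=; first by rewrite at0Z => ->; rewrite mulr0.
by move=> [p1 p2]; rewrite linearZ; split; apply: IHvs.
Qed.

Lemma annihB vs p q : annih vs p -> annih vs q -> annih vs (p - q).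
Proof. by move=> pv qv; rewrite -scaleN1r; apply/annihD/annihZ. Qed.

Lemma annih_sum (I : finType) (P : pred I) vs (F : I -> {mpoly K[n]}) :
  (forall i, P i -> annih vs (F i)) -> annih vs (\sum_(i | P i) F i).
Proof. by move=> FP; apply: big_ind; [exact: annih0|exact: annihD|]. Qed.

Lemma annih_move v s1 s2 p : annih (s1 ++ v :: s2) p <-> annih (v :: s1 ++ s2) p.
Proof.
elim: s1 p => [|w s1 IHs] p //=; rewrite !IHs /= (ddir_comm v w).
by split=> [] [[? ?] [? ?]].
Qed.

Lemma annih_perm vs ws p : perm_eq vs ws -> annih vs p <-> annih ws p.
Proof.
elim: vs ws p => [|v vs IHvs] ws p pe.
  by move: pe; rewrite perm_sym => /perm_nilP ->.
have /splitPr wsE : v \in ws by rewrite -(perm_mem pe) mem_head.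
case: wsE pe => s1 s2; rewrite perm_sym perm_catC cat_cons perm_cons perm_catC.
rewrite perm_sym => pe; rewrite annih_move /=.
by rewrite (IHvs _ p pe) (IHvs _ (ddir v p) pe).
Qed.

Lemma annih_scale (E : Type) (s : seq E) (v w : E -> 'rV[K]_n) (a : E -> K) p :
    (forall e, a e != 0) -> (forall e, w e = a e *: v e) ->
  annih (map v s) p <-> annih (map w s) p.
Proof.
move=> a0 wE; elim: s p => [|e s IHs] p //=.
rewrite wE ddir_vecZ -IHs; split=> [] [p1 p2]; split=> //.
  by rewrite -IHs; apply: annihZ.
have := annihZ (a e)^-1 (proj2 (IHs _) p2).
by rewrite scalerA mulVf ?scale1r.
Qed.

Lemma annih_at0 vs p : annih vs p -> at0 p = 0.
Proof. by elim: vs => [//|w vs IH] /= [/IH]. Qed.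

Lemma annih_mem vs v p : v \in vs -> annih vs p -> at0 (ddir v p) = 0.
Proof.
elim: vs => [//|w vs IHvs] /=; rewrite inE.
case/orP => [/eqP -> [_ /annih_at0]//|vvs [p1 _]].
exact: IHvs.
Qed.

(** Each derivative along a vector on which [h] varies uses up one factor [h]. Fewer than [k] such
    vectors occur, so a factor survives and vanishes at the origin. *)
Lemma annih_expr_linear vs h c k :
    at0 h = 0 -> (forall v, exists a, ddir v h = a%:MP) ->
    (count (fun v => ddir v h != 0)%R vs < k)%N ->
  annih vs (c * h ^+ k).
Proof.
move=> h0 hl; elim: vs c k => [|v vs IHvs] c k /=.
  by rewrite at0M at0Xn h0 expr0n; case: k => //= k _; rewrite mulr0.
move=> lt; split; first by apply: IHvs; apply: leq_ltn_trans lt; apply: leq_addl.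
rewrite ddirM ddirXn; apply: annihD.
  by apply: IHvs; apply: leq_ltn_trans lt; apply: leq_addl.
have [->|nz] := eqVneq (ddir v h) 0; first by rewrite mulr0 mul0rn mulr0; apply: annih0.
move: lt; rewrite nz; case: k => // k /=; rewrite add1n ltnS => lt.
rewrite mulrnAr mulrA mulrAC -mulrnAl.
exact: IHvs.
Qed.

Hypothesis hK : [pchar K] =i pred0.

Lemma natr_neq0 k : (k.+1%:R : K) != 0.
Proof. by rewrite (proj1 (pcharf0P _) hK). Qed.

(** Otherwise [k] vectors of [vs] with nonzero derivative of [p] at the origin could be used to
    strip all [k] factors, leaving a nonzero constant term. The induction carries a cofactor [c]
    with nonzero value at the origin, starting from 1. *)
Lemma annih_expr_lt vs p k : at0 p = 0 -> annih vs (p ^+ k) ->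
  (count (fun v => at0 (ddir v p) != 0)%R vs < k)%N.
Proof.
move=> p0; rewrite ltnNge -[p ^+ k]mul1r => kE; apply/negP.
have : at0 1 != 0 by rewrite -mpolyC1 at0C oner_eq0.
move: 1 kE; elim: vs k => [|v vs IHvs] k c /= kE c0.
  by rewrite leqn0 => /eqP k0; rewrite k0 expr0 mulr1 in kE; case/eqP: c0.
move: kE => [kE dkE].
have [le|lt le] := leqP k (count (fun v => at0 (ddir v p) != 0) vs).
  by have := IHvs _ _ kE c0; rewrite le.
move: le; have [|nz] := eqVneq (at0 (ddir v p)) 0.
  by rewrite add0n leqNgt lt.
case: k lt kE dkE => // k _ _ dkE; rewrite add1n ltnS.
(* This is the cofactor of [p ^+ k] in the derivative of [c * p ^+ k.+1]. Its value at the origin is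
   k+1 times the values of [c] and of [ddir v p], nonzero in characteristic zero. *)
apply: (IHvs k (ddir v c * p + (c * ddir v p) *+ k.+1)).
  move: dkE; rewrite ddirM ddirXn /= mulrDl -mulrA -exprS.
  by rewrite mulrnAr mulrCA mulrnAl [c * _ * _]mulrC.
rewrite at0D at0M p0 mulr0 add0r -mulr_natl at0M.
rewrite -(rmorph_nat (@mpolyC n K)) at0C at0M.
by rewrite !mulf_neq0 // natr_neq0.
Qed.
End DirectionalDerivative.

(** * Linear substitutions and the chain rule *)

Section LinearSubstitution.
Variables (K : fieldType) (m n : nat) (L : 'M[K]_(m, n)).
Implicit Types (p q : {mpoly K[n]}).

Definition lsubst p : {mpoly K[m]} :=
  p \mPo [tuple \sum_i L i j *: 'X_i | j < n].

Fact lsubst_is_linear : linear lsubst.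
Proof. by move=> a p q; rewrite /lsubst comp_mpolyD comp_mpolyZ. Qed.

Fact lsubst_is_monoid_morphism : monoid_morphism lsubst.
Proof.
by split=> [|p q]; rewrite /lsubst ?comp_mpoly1 // rmorphM.
Qed.

HB.instance Definition _ :=
  GRing.isLinear.Build K {mpoly K[n]} {mpoly K[m]} _ lsubst lsubst_is_linear.
HB.instance Definition _ :=
  GRing.isMonoidMorphism.Build {mpoly K[n]} {mpoly K[m]} lsubst
    lsubst_is_monoid_morphism.

Lemma lsubstC c : lsubst c%:MP = c%:MP.
Proof. exact: comp_mpolyC. Qed.

Lemma lsubstX j : lsubst 'X_j = \sum_i L i j *: 'X_i.
Proof. by rewrite /lsubst comp_mpolyXU (nth_map j) ?size_enum_ord // nth_ord_enum. Qed.

Lemma at0_lsubst p : at0 (lsubst p) = at0 p.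
Proof.
elim/mpoly_alg_ind: p => [c|j|p q IHp IHq|p q IHp IHq].
- by rewrite lsubstC !at0C.
- by rewrite lsubstX at0X at0_sum big1 // => i _; rewrite at0Z at0X mulr0.
- by rewrite rmorphD !at0D IHp IHq.
- by rewrite rmorphM !at0M IHp IHq.
Qed.

Lemma ddir_lsubst v p : ddir v (lsubst p) = lsubst (ddir (v *m L) p).
Proof.
elim/mpoly_alg_ind: p => [c|j|p q IHp IHq|p q IHp IHq].
- by rewrite lsubstC !ddirC raddf0.
- rewrite lsubstX ddirX lsubstC mxE (linear_sum (ddir v)) raddf_sum /=.
  by apply: eq_bigr => i _; rewrite linearZ /= ddirX mulrC mpolyCM mul_mpolyC.
- by rewrite !raddfD /= IHp IHq.
- by rewrite rmorphM !ddirM raddfD /= !rmorphM IHp IHq.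
Qed.

Lemma annih_lsubst (vs : seq 'rV[K]_m) p :
  annih vs (lsubst p) <-> annih (map (mulmxr L) vs) p.
Proof.
elim: vs p => [|v vs IHvs] p /=; first by rewrite at0_lsubst.
by rewrite ddir_lsubst !IHvs.
Qed.

Lemma dhomog_lsubst d p : p \is d.-homog -> lsubst p \is d.-homog.
Proof.
move=> dp; rewrite [p]mpolyE raddf_sum big_seq rpred_sum //= => k kp.
rewrite linearZ rpredZ // mpolyXE_id rmorph_prod /=.
rewrite -(dhomog_mf dp kp) /= mdegE.
elim: (index_enum _) => [|i s IHs]; first by rewrite !big_nil dhomog1.
have hX : lsubst 'X_i \is 1.-homog.
  rewrite lsubstX rpred_sum // => j _.
  by rewrite rpredZ // dhomogX; apply/eqP/mdeg1.
rewrite !big_cons; apply: dhomogM IHs; rewrite rmorphXn /= -[X in X.-homog]mul1n.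
exact: dhomogMn hX.
Qed.
End LinearSubstitution.

(** * The cut ideal as an annihilator *)

Section PowerIdeal.
Variables (K : fieldType) (n : nat).
Hypothesis hK : [pchar K] =i pred0.
Implicit Types (p q t : {mpoly K[n]}) (v : 'rV[K]_n) (E : seq ('I_n * 'I_n)).
Implicit Types (I : {set 'I_n}) (e : 'I_n * 'I_n).

(** Integration by parts: the integral of c t^k is c t^(k+1) / ((k+1) a) minus a multiple of the
    integral of c' t^(k+1). The recursion stops because iterated derivatives of [c] vanish. *)
Lemma antiderivative v t a c k : a != 0 -> ddir v t = a%:MP ->
  exists q, ddir v (q * t ^+ k.+1) = c * t ^+ k.
Proof.
move=> a0 vt; have [m] := ddir_nilpotent v c.
elim: m c k => [|m IHm] c k; first by move=> /= ->; exists 0; rewrite !mul0r linear0.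
rewrite iterSr => /(IHm _ k.+1)[q qE].
have b0 : k.+1%:R * a != 0 by rewrite mulf_neq0 ?natr_neq0.
exists ((k.+1%:R * a)^-1 *: (c - q * t)).
rewrite -scalerAl linearZ /= mulrBl linearB /= -mulrA -exprS qE.
rewrite ddirM addrAC subrr add0r ddirXn vt /=.
apply: (@scalerI _ _ (k.+1%:R * a)) => //; rewrite scalerA mulfV // scale1r.
by rewrite -mul_mpolyC mpolyCM (rmorph_nat (@mpolyC n K)); ring.
Qed.

(** Edges are ordered pairs with loops allowed, since contraction creates loops. A loop has zero
    arrow and crosses no cut. *)
Definition arrow e : 'rV[K]_n := delta_mx 0 e.1 - delta_mx 0 e.2.

Definition sumX I : {mpoly K[n]} := \sum_(i in I) 'X_i.

Definition cut E I := count (fun e => (e.1 \in I) != (e.2 \in I)) E.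

Definition cut_ideal E p : Prop :=
  exists c : {set 'I_n} -> {mpoly K[n]},
    p = \sum_(I : {set 'I_n} | I != set0) c I * sumX I ^+ (cut E I).+1.

Lemma cut_ideal0 E : cut_ideal E 0.
Proof. by exists (fun=> 0); rewrite big1 // => I _; rewrite mul0r. Qed.

Lemma cut_idealD E p q : cut_ideal E p -> cut_ideal E q -> cut_ideal E (p + q).
Proof.
case=> c -> [d ->]; exists (fun I => c I + d I).
by rewrite -big_split; apply: eq_bigr => I _; rewrite mulrDl.
Qed.

Lemma cut_idealM E a p : cut_ideal E p -> cut_ideal E (a * p).
Proof.
case=> c ->; exists (fun I => a * c I).
by rewrite mulr_sumr; apply: eq_bigr => I _; rewrite mulrA.
Qed.

Lemma cut_ideal_sum (T : Type) (s : seq T) (P : pred T) E (F : T -> {mpoly K[n]}) :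
  (forall i, P i -> cut_ideal E (F i)) -> cut_ideal E (\sum_(i <- s | P i) F i).
Proof. by move=> FP; apply: big_ind; [exact: cut_ideal0|exact: cut_idealD|]. Qed.

Lemma cut_ideal_gen E I a k : (cut E I < k)%N -> cut_ideal E (a * sumX I ^+ k).
Proof.
have [->|I0] := eqVneq I set0.
  rewrite /sumX big_set0 expr0n; case: k => // k _; rewrite mulr0.
  exact: cut_ideal0.
move=> lt; rewrite -(subnK lt) exprD mulrA; apply: cut_idealM.
exists (fun J => (J == I)%:R); rewrite (bigD1 I) //= eqxx mul1r big1 ?addr0 //.
by move=> J /andP[_ /negPf ->]; rewrite mul0r.
Qed.

Lemma at0_sumX I : at0 (sumX I) = 0.
Proof. by rewrite /sumX at0_sum big1 // => i _; rewrite at0X. Qed.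

Lemma ddir_sumX v I : ddir v (sumX I) = (\sum_(i in I) v 0 i)%:MP.
Proof.
rewrite /sumX (linear_sum (ddir v)) (raddf_sum (@mpolyC n K)) /=.
by apply: eq_bigr => i _; rewrite ddirX.
Qed.

Lemma sum_arrow e I :
  \sum_(i in I) arrow e 0 i = (e.1 \in I)%:R - (e.2 \in I)%:R :> K.
Proof.
have del j : \sum_(i in I) (delta_mx 0 j : 'rV[K]_n) 0 i = (j \in I)%:R.
  have [jI|jI] := boolP (j \in I); last first.
    rewrite big1 // => i iI; rewrite mxE eqxx /=.
    by case: eqP iI jI => // -> ->.
  rewrite (bigD1 j) //= mxE !eqxx big1 ?addr0 // => i /andP[_ /negPf ij].
  by rewrite mxE ij andbF.
rewrite -!del -sumrB; apply: eq_bigr => i _; by rewrite !mxE.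
Qed.

Lemma ddir_arrow_sumX e I :
  ddir (arrow e) (sumX I) = ((e.1 \in I)%:R - (e.2 \in I)%:R)%:MP.
Proof. by rewrite ddir_sumX sum_arrow. Qed.

Lemma cut_arrow E I :
  count (fun v => ddir v (sumX I) != 0)%R (map arrow E) = cut E I.
Proof.
rewrite count_map; apply: eq_count => e /=; rewrite ddir_arrow_sumX mpolyC_eq0.
case: (_ \in I); case: (_ \in I); rewrite ?subrr ?eqxx ?subr0 ?oner_eq0 //.
by rewrite sub0r oppr_eq0 oner_eq0.
Qed.

(** The edges crossing [I] are exactly those along which [sumX I] varies, so [annih_expr_linear]
    applies to every generator. *)
Lemma cut_ideal_annih E p : cut_ideal E p -> annih (map arrow E) p.
Proof.
case=> c ->; apply: annih_sum => I _; apply: annih_expr_linear.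
- exact: at0_sumX.
- by move=> v; eexists; apply: ddir_sumX.
- by rewrite cut_arrow.
Qed.

(** Without edges the singletons contribute the variables themselves, which generate the maximal
    ideal of the origin. *)
Lemma cut_ideal_nil p : at0 p = 0 -> cut_ideal [::] p.
Proof.
move=> p0; rewrite [p]mpolyE; apply: cut_ideal_sum => m _.
have [->|m0] := eqVneq m 0%MM.
  have -> : p@_0 = 0.
    rewrite -p0; elim/mpoly_alg_ind: {p0} p => [c|i|p q IHp IHq|p q IHp IHq].
    - by rewrite at0C mcoeffC eqxx mulr1.
    - by rewrite at0X mcoeffX -mdeg_eq0 mdeg1.
    - by rewrite at0D mcoeffD IHp IHq.
    - by rewrite at0M -IHp -IHq (rmorphM (mcoeff 0%MM)).
  by rewrite scale0r; apply: cut_ideal0.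
have [i mi] : exists i, (m i != 0)%N.
  apply/existsP; apply: contraNT m0; rewrite negb_exists => /forallP m0.
  by apply/eqP/mnmP => i; rewrite mnm0E; apply/eqP/negPn/m0.
have -> : m = (m - U_(i) + U_(i))%MM.
  by rewrite submK //; apply/mnm_lepP => j; rewrite mnm1E; case: eqP => // <-; rewrite lt0n.
rewrite mpolyXD -mul_mpolyC mulrA.
have -> : 'X_i = sumX [set i] ^+ 1 by rewrite expr1 /sumX big_set1.
exact: cut_ideal_gen.
Qed.

Section Merge.
Variable rho : 'I_n -> 'I_n.

Definition merge_mx : 'M[K]_n := \matrix_(i, j) (rho i == j)%:R.

Lemma lsubst_merge_sumX I :
  lsubst merge_mx (sumX I) = sumX (rho @^-1: I).
Proof.
rewrite /sumX raddf_sum /=.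
transitivity (\sum_(j in I) \sum_(i | rho i == j) 'X_i : {mpoly K[n]}).
  apply: eq_bigr => j _; rewrite lsubstX [RHS]big_mkcond; apply: eq_bigr => i _.
  by rewrite mxE; case: eqP; rewrite ?scale1r ?scale0r.
rewrite (exchange_big_dep (mem (rho @^-1: I))) /= => [|j i jI /eqP ij]; last first.
  by rewrite inE ij.
apply: eq_bigr => i; rewrite inE => iI; rewrite (big_pred1 (rho i)) // => j /=.
by rewrite [rho i == j]eq_sym; case: eqP => [->|]; rewrite ?andbF // iI.
Qed.

(** An edge crosses the preimage of [I] under [rho] exactly when its image crosses [I], so
    generators go to generators with the same exponent. *)
Lemma lsubst_merge_cut_ideal E p :
  cut_ideal (map (fun e => (rho e.1, rho e.2)) E) p ->
  cut_ideal E (lsubst merge_mx p).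
Proof.
case=> c ->; rewrite raddf_sum; apply: cut_ideal_sum => I _ /=.
rewrite rmorphM rmorphXn /= lsubst_merge_sumX; apply: cut_ideal_gen.
rewrite ltnS /cut count_map; apply: eq_leq; apply: eq_count => e /=.
by rewrite !inE.
Qed.

Lemma arrow_mul_merge e : arrow e *m merge_mx = arrow (rho e.1, rho e.2).
Proof.
rewrite mulmxBl -!rowE; congr (_ - _); apply/rowP => j;
  by rewrite !mxE eq_sym.
Qed.
End Merge.

Section Contraction.
Variables (u w : 'I_n).
Hypothesis uw : u != w.
(** Collapsing [w] onto [u] makes [sigma] send x_u to x_u + x_w and x_w to 0, and fix the other
    variables. *)
Let rho (i : 'I_n) := if i == w then u else i.
Local Notation d := (ddir (arrow (u, w))).
Local Notation sigma := (lsubst (merge_mx rho)).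

Lemma ddir_merge p : d (sigma p) = 0.
Proof.
rewrite ddir_lsubst arrow_mul_merge /= /rho eqxx (negPf uw) /arrow subrr.
by rewrite ddir_vec0 raddf0.
Qed.

Lemma merge_modX p : exists q, p - sigma p = 'X_w * q.
Proof.
elim/mpoly_alg_ind: p => [c|i|p q [p' pE] [q' qE]|p q [p' pE] [q' qE]].
- by exists 0; rewrite lsubstC subrr mulr0.
- rewrite lsubstX.
  have sE : \sum_j merge_mx rho j i *: 'X_j =
      (i != w)%:R *: 'X_i + (i == u)%:R *: 'X_w :> {mpoly K[n]}.
    rewrite (bigD1 w) //= mxE /rho eqxx addrC [u == i]eq_sym; congr (_ + _).
    have [->|iw] := eqVneq i w.
      rewrite scale0r big1 // => j jw; by rewrite mxE (negPf jw) (negPf jw) scale0r.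
    rewrite (bigD1 i) //= mxE (negPf iw) eqxx big1 ?addr0 // => j /andP[jw ji].
    by rewrite mxE (negPf jw) (negPf ji) scale0r.
  rewrite sE; have [->|iw] := eqVneq i w.
    by exists (1 - (w == u)%:R%:MP); rewrite scale0r add0r -mul_mpolyC; ring.
  by exists (- (i == u)%:R%:MP); rewrite scale1r -mul_mpolyC; ring.
- by exists (p' + q'); rewrite raddfD mulrDr -pE -qE /=; ring.
- exists (p' * q + sigma p * q'); rewrite rmorphM /= mulrDr mulrA -pE (mulrCA _ (sigma p)) -qE.
  by ring.
Qed.

(* Modulo [x_w] the substitution is the identity, and [d] is injective on the
   multiples of [x_w]. *)
Lemma merge_id p : d p = 0 -> sigma p = p.
Proof.
move=> dp; apply/esym/eqP; rewrite -subr_eq0; apply/eqP.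
have [q qE] := merge_modX p; rewrite qE.
have dX : d 'X_w = -1.
  by rewrite ddirX !mxE !eqxx /= eq_sym (negPf uw) sub0r mpolyCN mpolyC1.
have /eqP : d ('X_w * q) = 0 by rewrite -qE linearB /= dp ddir_merge subr0.
rewrite ddirM dX mulN1r addrC subr_eq0 => /eqP dq.
suff -> : q = 0 by rewrite mulr0.
(* As q = x_w d(q), the Leibniz rule yields (k+1) d^k(q) = x_w d^(k+1)(q). Hence the vanishing of
   some iterate descends to [q] itself. *)
have iter_d k : iter k d ('X_w * d q) = 'X_w * iter k.+1 d q - iter k d q *+ k.
  elim: k => [|k IHk]; first by rewrite subr0.
  rewrite iterS {}IHk linearB linearMn /= ddirM dX mulrS.
  by set D := d (iter k d q); set Dk := D *+ k; ring.
have [k] := ddir_nilpotent (arrow (u, w)) q.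
elim: k => [//|k IHk] kq; apply: IHk.
have := iter_d k; rewrite dq kq mulr0 sub0r => /eqP.
rewrite -addr_eq0 -mulrS -mulr_natl -(rmorph_nat (@mpolyC n K)) mul_mpolyC.
by rewrite scaler_eq0 (negPf (natr_neq0 hK k)) => /eqP.
Qed.

Lemma annih_merge E p : d p = 0 ->
  annih (map arrow E) p ->
  annih (map arrow (map (fun e => (rho e.1, rho e.2)) E)) p.
Proof.
move=> dp pE; have : annih (map arrow E) (sigma p) by rewrite merge_id.
rewrite annih_lsubst -!map_comp.
by under eq_map => e do rewrite /= arrow_mul_merge.
Qed.
End Contraction.

Theorem cut_idealP E p : cut_ideal E p <-> annih (map arrow E) p.
Proof.
split; first exact: cut_ideal_annih.
move: {2}(size E) (erefl (size E)) => k sE.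
elim: k E sE p => [|k IHk] [|e E] //= => [_|[sE]] p; first exact: cut_ideal_nil.
case: e => u w [pE dpE].
have [uw|uw] := eqVneq u w.
  have [c ->] := IHk _ sE p pE.
  apply: cut_ideal_sum => I _; apply: cut_ideal_gen.
  by rewrite /cut /= uw eqxx.
have [c cE] := IHk _ sE _ dpE.
(* If [uw] crosses [I], integrating in the direction of [sumX I] raises its exponent by one, just as
   adding the edge raises the cut. Otherwise [sumX I] is constant along the edge, and only the
   coefficient is integrated, with respect to x_u. *)
have prim I : exists2 q, cut_ideal ((u, w) :: E) q &
    ddir (arrow (u, w)) q = c I * sumX I ^+ (cut E I).+1.
  have dI := ddir_arrow_sumX (u, w) I; rewrite /= in dI.
  have [sep|nsep] := boolP ((u \in I) != (w \in I)).
    have a0 : (u \in I)%:R - (w \in I)%:R != 0 :> K.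
      case: (u \in I) (w \in I) sep => [] [] //= _.
        by rewrite subr0 oner_eq0.
      by rewrite sub0r oppr_eq0 oner_eq0.
    have [q qE] := antiderivative (c I) (cut E I).+1 a0 dI.
    exists (q * sumX I ^+ (cut E I).+2) => //.
    by apply: cut_ideal_gen; rewrite /cut /= sep add1n.
  have d1 : ddir (arrow (u, w)) 'X_u = 1%:MP.
    by rewrite ddirX !mxE !eqxx (negPf uw) subr0.
  have o0 : (1 : K) != 0 by apply: oner_neq0.
  have [q qE] := antiderivative (c I) 0 o0 d1.
  exists (q * 'X_u ^+ 1 * sumX I ^+ (cut E I).+1).
    by apply: cut_ideal_gen; rewrite /cut /= (negPf nsep).
  have dI0 : ddir (arrow (u, w)) (sumX I) = 0.
    by rewrite dI; move/negPn/eqP: nsep => ->; rewrite subrr mpolyC0.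
  by rewrite ddirM qE expr0 mulr1 ddirXn dI0 mulr0 mul0rn mulr0 addr0.
have /boolp.choice[F FP] : forall I, exists q, cut_ideal ((u, w) :: E) q /\
    ddir (arrow (u, w)) q = c I * sumX I ^+ (cut E I).+1.
  by move=> I; have [q] := prim I; exists q.
pose q := \sum_(I : {set 'I_n} | I != set0) F I.
have qJ : cut_ideal ((u, w) :: E) q by apply: cut_ideal_sum => I _; case: (FP I).
have dq : ddir (arrow (u, w)) (p - q) = 0.
  rewrite linearB /= cE (linear_sum (ddir _)) /= -sumrB big1 // => I _.
  by rewrite (proj2 (FP I)) subrr.
rewrite -(subrK q p); apply: cut_idealD => //.
have [qE _] := cut_ideal_annih qJ.
(* The remainder [p - q] is constant along the edge, so it is pulled back from the contraction,
   where the induction hypothesis applies. The edge [uw] itself becomes a loop there and changes no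
   cut. *)
rewrite -(merge_id uw dq).
apply: lsubst_merge_cut_ideal.
have := IHk _ _ _ (annih_merge uw dq (annihB pE qE)).
rewrite size_map => /(_ sE)[c' ->]; apply: cut_ideal_sum => I _.
by apply: cut_ideal_gen; rewrite /cut /= eqxx (negPf uw) eqxx.
Qed.
End PowerIdeal.

Arguments arrow K {n} e.

(** * Forests and edge vectors *)

Lemma uniq_map_inj (T1 T2 : eqType) (f : T1 -> T2) (s : seq T1) :
  uniq (map f s) -> {in s &, injective f}.
Proof.
elim: s => //= z s IHs /andP[fz /IHs inj] x y; rewrite !inE.
case/orP => [/eqP ->|xs] /orP[/eqP ->|ys] // E; last exact: inj.
  by rewrite E map_f in fz.
by rewrite -E map_f in fz.
Qed.

Section Independence.
Variables (K : fieldType) (n : nat) (E : finType) (v : E -> 'rV[K]_n).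

Definition independent (A : {set E}) : Prop :=
  forall c : E -> K, \sum_(e in A) c e *: v e = 0 -> forall e, e \in A -> c e = 0.
End Independence.

Section EdgeVectors.
Variables (K : fieldType) (G : multigraph).
Implicit Types (e f : edge G) (A : {set edge G}).

Lemma orient_exists e : exists uw : 'I_(nvertices G) * 'I_(nvertices G),
  ends e == [set uw.1; uw.2].
Proof. by have [u [w E]] := endsP e; exists (u, w); rewrite E. Qed.

Definition orient e : 'I_(nvertices G) * 'I_(nvertices G) := xchoose (orient_exists e).

Lemma orientE e : ends e = [set (orient e).1; (orient e).2].
Proof. exact/eqP/(xchooseP (orient_exists e)). Qed.

Definition orientation := map orient (enum (edge G)).

Definition edge_vec e : 'rV[K]_(nvertices G) := arrow K (orient e).

Lemma edge_vec_neq0 e : edge_vec e != 0.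
Proof.
have := ends_neq (orientE e); apply: contraNneq => /rowP/(_ (orient e).1).
rewrite !mxE !eqxx /=; case: eqP => [//|_] /eqP.
by rewrite subr0 oner_eq0.
Qed.

Lemma map_edge_vec : map edge_vec (enum (edge G)) = map (arrow K) orientation.
Proof. by rewrite /orientation; elim: (enum _) => [|e s /= ->]. Qed.

Lemma cut_orientation (I : {set 'I_(nvertices G)}) : cut orientation I = cut_size I.
Proof.
rewrite /cut count_map /cut_size -sum1_count -sum1_card big_enum_cond /=.
apply: eq_bigl => e; rewrite inE.
apply/idP/existsP => [|[u /andP[uI /existsP[w /andP[wI]]]]].
  have aE := orientE e.
  have [u1 u2|u1 /= /negPn u2] := boolP ((orient e).1 \in I).
    exists (orient e).1; rewrite u1; apply/existsP; exists (orient e).2.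
    by rewrite inE aE eqxx andbT; case: (_ \in I) u2.
  exists (orient e).2; rewrite u2; apply/existsP; exists (orient e).1.
  by rewrite inE aE setUC eqxx andbT; case: (_ \in I) u1.
rewrite inE in wI; rewrite orientE => /eqP E.
have neq : u != w by apply: contraNneq wI => <-.
have: (orient e).1 \in [set u; w] by rewrite -E !inE eqxx.
have: (orient e).2 \in [set u; w] by rewrite -E !inE eqxx orbT.
have a12 := ends_neq (orientE e).
rewrite !inE => /orP[]/eqP a2 /orP[]/eqP a1; rewrite a1 a2 ?uI ?(negPf wI) //;
  by rewrite a1 a2 eqxx in a12.
Qed.

Lemma JF_annih (hK : [pchar K] =i pred0) p :
  JF p <-> annih (map edge_vec (enum (edge G))) p.
Proof.
rewrite map_edge_vec -cut_idealP //; split.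
  move/asboolP => [c ->]; exists c; apply: eq_bigr => I _.
  by rewrite cut_orientation.
case=> c ->; apply/asboolP; exists c; apply: eq_bigr => I _.
by rewrite cut_orientation.
Qed.

(** A relation is paired with the indicator function of the component of one end of [e] in [A :\ e].
    Every other edge of [A] has both ends on one side, while [e] is a bridge, so only the
    coefficient of [e] remains. *)
Lemma forest_independent A : forest A -> independent edge_vec A.
Proof.
move=> fA c c0 e eA.
have br := forest_bridge fA eA (orientE e).
set u := (orient e).1 in br; set w := (orient e).2 in br.
pose chi (x : 'I_(nvertices G)) : K := (connect (adj (A :\ e)) u x)%:R.
pose h : 'cV[K]_(nvertices G) := \col_x chi x.
have pair f : (edge_vec f *m h) 0 0 = chi (orient f).1 - chi (orient f).2.
  by rewrite mulmxBl -!rowE !mxE.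
have /= := congr1 (fun x => (x *m h) 0 0) c0.
rewrite mul0mx [RHS]mxE mulmx_suml summxE (bigD1 e) //= -scalemxAl mxE pair.
rewrite big1 => [|f /andP[fA' fe]].
  by rewrite /chi connect0 (negPf br) subr0 mulr1 addr0.
rewrite -scalemxAl mxE pair /chi.
suff -> : connect (adj (A :\ e)) u (orient f).1 = connect (adj (A :\ e)) u (orient f).2.
  by rewrite subrr mulr0.
apply/same_connect_r; last first.
  by apply/connect1/existsP; exists f; rewrite !inE fe fA' orientE eqxx.
by apply: sym_connect_sym; apply: adj_sym.
Qed.

Definition sgn_from (x : 'I_(nvertices G)) e : K := if (orient e).1 == x then 1 else -1.

Lemma sgn_from_step p q : step p q ->
  sgn_from p.1 p.2 *: edge_vec p.2 = delta_mx 0 p.1 - delta_mx 0 q.1.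
Proof.
move/eqP => E; have pq := ends_neq E.
rewrite orientE in E.
have: (orient p.2).1 \in [set p.1; q.1] by rewrite -E !inE eqxx.
have: (orient p.2).2 \in [set p.1; q.1] by rewrite -E !inE eqxx orbT.
have a12 := ends_neq (orientE p.2).
rewrite !inE /sgn_from /edge_vec /arrow => /orP[]/eqP a2 /orP[]/eqP a1;
  rewrite a1 a2 ?eqxx ?scale1r //.
- by rewrite a1 a2 eqxx in a12.
- by rewrite eq_sym (negPf pq) scaleN1r opprB.
- by rewrite a1 a2 eqxx in a12.
Qed.

Lemma path_telescope p c : path (@step G) p c ->
  \sum_(q <- belast p c) sgn_from q.1 q.2 *: edge_vec q.2 =
  delta_mx 0 p.1 - delta_mx 0 (last p c).1.
Proof.
elim: c p => [|q c IHc] p /=; first by rewrite big_nil subrr.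
case/andP => /sgn_from_step pq /IHc; rewrite big_cons pq => ->.
by rewrite addrA subrK.
Qed.

(** The edge vectors of a cycle, oriented along it, telescope to zero. That the coefficients are 0,
    1 or -1 is the regularity on which the sign argument for matroid isomorphisms rests. *)
Lemma not_forest A : ~ forest A -> exists2 a : edge G -> K,
    \sum_e a e *: edge_vec e = 0 &
  [/\ exists e, a e != 0, forall e, a e != 0 -> e \in A
    & forall e, [\/ a e = 0, a e = 1 | a e = -1]].
Proof.
move=> nf.
have [c cc sc] : exists2 c, is_cycle c & {subset unzip2 c <= A}.
  by apply: contrapT => nex; apply: nf => c cc sc; apply: nex; exists c.
have /and4P[c0 _ U2 cyc] := cc.
(* The edges of the cycle are distinct, so this sum has at most one term. *)
pose a e : K := \sum_(q <- c | q.2 == e) sgn_from q.1 q.2.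
have aq q : q \in c -> a q.2 = sgn_from q.1 q.2.
  move=> qc; rewrite /a big_mkcond (bigD1_seq q) ?eqxx //=; last exact: map_uniq U2.
  rewrite big1_seq ?addr0 // => r /andP[nrq rc]; case: eqP => // rq.
  by case/eqP: nrq; apply: (uniq_map_inj U2).
have a0 e : e \notin unzip2 c -> a e = 0.
  move=> ec; rewrite /a big1_seq // => q /andP[/eqP qe qc].
  by rewrite -qe map_f in ec.
have av e : [\/ a e = 0, a e = 1 | a e = -1].
  have [/mapP[q qc ->]|/a0 ->] := boolP (e \in unzip2 c); last by constructor 1.
  by rewrite aq // /sgn_from; case: ifP; [constructor 2|constructor 3].
exists a; last split=> //.
- transitivity (\sum_(q <- c) sgn_from q.1 q.2 *: edge_vec q.2).
    rewrite /a; under eq_bigr => e _ do rewrite scaler_suml.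
    rewrite (exchange_big_dep xpredT) //=; apply: eq_bigr => q _.
    by rewrite (big_pred1 q.2) // => e /=; rewrite eq_sym.
  case: c cyc {cc sc c0 U2 a aq a0 av} => [|p c] /=; first by rewrite big_nil.
  by move/path_telescope; rewrite belast_rcons last_rcons subrr.
- have [q qc] : exists q, q \in c.
    by case: (c) c0 => // q s _; exists q; apply: mem_head.
  exists q.2; rewrite aq // /sgn_from.
  by case: ifP; rewrite ?oppr_eq0 oner_eq0.
- by move=> e; apply: contraR => eA; rewrite a0 //; apply: contra eA; apply: sc.
Qed.

Lemma forestP A : forest A <-> independent edge_vec A.
Proof.
split; first exact: forest_independent.
move=> iA; apply: contrapT => /not_forest[a a0 [[e ae] aA _]].
case/eqP: (ae); apply: (iA a) => //; last exact: aA.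
apply: etrans a0; rewrite [RHS](bigID (mem A)) /= [X in _ + X]big1 ?addr0 // => f fA.
by have [->|/aA] := eqVneq (a f) 0; rewrite ?scale0r // (negPf fA).
Qed.
End EdgeVectors.

(** * Weight-preserving configurations *)

Section Avoidance.
Variables (K : fieldType).
Hypothesis hK : [pchar K] =i pred0.

Lemma nonroot_exists (p : {poly K}) : p != 0 -> exists a, p.[a] != 0.
Proof.
move=> p0; apply: contrapT => nex.
have inj : injective (fun k : nat => k%:R : K).
  move=> i j /eqP; wlog ij : i j / (i <= j)%N.
    by move=> W; have [/W//|/ltnW/W{}W] := leqP i j; rewrite eq_sym => /W.
  rewrite eq_sym -subr_eq0 -natrB // (proj1 (pcharf0P _) hK) subn_eq0 => ji.
  by apply/eqP; rewrite eqn_leq ij.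
pose s := map (fun k : nat => k%:R : K) (iota 0 (size p)).
have := @max_poly_roots _ p s p0.
rewrite size_map size_iota ltnn => F; suff: false by [].
apply: F; last by rewrite map_inj_uniq ?iota_uniq.
by apply/allP => a _; apply/rootP/eqP; apply: contrapT => /negP ?; apply: nex; exists a.
Qed.

Variable n : nat.

(** Finitely many hyperplanes do not cover a space over an infinite field. Given [h] good for [zs]
    and a coordinate [g] good for [z], a point of the line h + a g is chosen outside the roots of
    the affine functions [P y]. *)
Lemma common_nonvanishing k (C : 'M[K]_(n, k)) (zs : seq 'rV[K]_n) :
    (forall z, z \in zs -> z *m C != 0) ->
  exists h : 'cV[K]_k, forall z, z \in zs -> z *m C *m h != 0.
Proof.
elim: zs => [|z zs IHzs] nz; first by exists 0.
have [h hP] : exists h : 'cV[K]_k, forall y, y \in zs -> y *m C *m h != 0.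
  by apply: IHzs => y yz; apply: nz; rewrite inE yz orbT.
have [j zj] : exists j, (z *m C) 0 j != 0.
  apply/existsP; apply: contraR (nz z (mem_head _ _)); rewrite negb_exists.
  by move=> /forallP z0; apply/eqP/rowP => j; by apply: etrans (eqP (negbNE (z0 j))) _; rewrite mxE.
pose g : 'cV[K]_k := delta_mx j 0.
pose P (y : 'rV[K]_n) : {poly K} := ((y *m C *m h) 0 0)%:P + ((y *m C *m g) 0 0) *: 'X.
have P0 y : y \in z :: zs -> P y != 0.
  move=> yz; apply/eqP => Py0.
  have := congr1 (coefp 0) Py0; have := congr1 (coefp 1) Py0.
  rewrite /P /= !coefD !coefC !coefZ !coefX ?coef0 /= !mulr1 mulr0 addr0 add0r.
  move: yz; rewrite inE => /orP[/eqP ->|yz] y1 y0.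
    by move: y1; rewrite -colE mxE => /eqP; rewrite (negPf zj).
  case/eqP: (hP y yz); apply/matrixP => r c.
  by rewrite !ord1 y0 mxE.
have [a] : exists a, (\prod_(y <- z :: zs) P y).[a] != 0.
  apply: nonroot_exists; rewrite prodf_seq_neq0; apply/allP => y yz /=.
  exact: P0.
rewrite horner_prod prodf_seq_neq0 => /allP aP.
exists (h + a *: g) => y yz; have := aP y yz; apply: contra => /= /eqP yh.
have := congr1 (fun M : 'M_1 => M 0 0) yh.
rewrite mulmxDr -scalemxAr /= !hornerE [RHS]mxE [LHS]mxE => <-.
by rewrite [X in _ == _ + X]mxE mulrC.
Qed.
End Avoidance.

Section MacWilliams.
Variables (K : fieldType) (n : nat) (E F : finType).
Variables (v : E -> 'rV[K]_n) (w : F -> 'rV[K]_n).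
Hypothesis hK : [pchar K] =i pred0.
Hypothesis v0 : forall e, v e != 0.
Hypothesis w0 : forall f, w f != 0.
Hypothesis weight_eq : forall h : 'cV[K]_n,
  #|[set e | v e *m h != 0]| = #|[set f | w f *m h != 0]|.

(** A generic functional among those killing [l] kills, of all the vectors [v e] and [w f], only the
    multiples of [l]. The range of [cokermx l] consists of functionals killing [l], so [weight_eq]
    applied to a generic one compares the two counts. *)
Lemma card_nonmultiples (l : 'rV[K]_n) :
  #|[set e | ~~ (v e <= l)%MS]| = #|[set f | ~~ (w f <= l)%MS]|.
Proof.
pose zs := [seq z <- map v (enum E) ++ map w (enum F) | ~~ (z <= l)%MS].
have [|h hP] := @common_nonvanishing _ hK _ _ (cokermx l) zs.
  by move=> z; rewrite mem_filter submxE => /andP[].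
have key (X : finType) (x : X -> 'rV[K]_n) :
    {subset map x (enum X) <= map v (enum E) ++ map w (enum F)} ->
    [set e | ~~ (x e <= l)%MS] = [set e | x e *m (cokermx l *m h) != 0].
  move=> sub; apply/setP => e; rewrite !inE mulmxA submxE; apply/idP/idP => [nz|].
    by apply: hP; rewrite mem_filter submxE nz sub // map_f ?mem_enum.
  by apply: contra => /eqP ->; rewrite mul0mx.
rewrite !key ?weight_eq // => z zs'; by rewrite mem_cat zs' ?orbT.
Qed.

(** Taking [l] zero in [card_nonmultiples] equates the sizes of [E] and [F]; complements are then
    subtracted. *)
Lemma card_multiples (l : 'rV[K]_n) :
  #|[set e | (v e <= l)%MS]| = #|[set f | (w f <= l)%MS]|.
Proof.
have all : #|E| = #|F|.
  have vT : [set e | ~~ (v e <= (0%R : 'rV[K]_n))%MS] = setT.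
    by apply/setP => e; rewrite !inE; apply: contraNN (v0 e) => /submx0null ->.
  have wT : [set f | ~~ (w f <= (0%R : 'rV[K]_n))%MS] = setT.
    by apply/setP => f; rewrite !inE; apply: contraNN (w0 f) => /submx0null ->.
  by have := card_nonmultiples 0; rewrite vT wT !cardsT.
have C (X : finType) (x : X -> 'rV[K]_n) :
    #|[set e | (x e <= l)%MS]| = (#|X| - #|[set e | ~~ (x e <= l)%MS]|)%N.
  rewrite -(cardsC [set e | (x e <= l)%MS]).
  have -> : ~: [set e | (x e <= l)%MS] = [set e | ~~ (x e <= l)%MS].
    by apply/setP => e; rewrite !inE.
  by rewrite addnK.
by rewrite !C all card_nonmultiples.
Qed.

Lemma rV_submx_sym (x y : 'rV[K]_n) : x != 0 -> (x <= y)%MS -> (y <= x)%MS.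
Proof.
move=> x0 /sub_rVP[a xE]; have a0 : a != 0.
  by apply: contraNneq x0 => a0; rewrite xE a0 scale0r.
by apply/sub_rVP; exists a^-1; rewrite xE scalerA mulVf ?scale1r.
Qed.

(** By [card_multiples] each line contains equally many vectors of either family. The canonical
    matrices [<<v e>>] and [<<w f>>] name these lines, so the two lists of lines are permutations of
    each other, and the permutation matches the indices. *)
Theorem macwilliams : exists2 f : E -> F, bijective f &
  forall e, exists2 a, a != 0 & w (f e) = a *: v e.
Proof.
have gen (x y : 'rV[K]_n) : x != 0 -> y != 0 -> (<<x>>%MS == <<y>>%MS) = (x <= y)%MS.
  move=> x0 y0; apply/eqP/idP => [xy|xy].
    by rewrite -genmxE xy genmxE.
  by apply/genmxP; rewrite xy rV_submx_sym.
have pe : perm_eq [seq <<v e>>%MS | e <- enum E] [seq <<w e>>%MS | e <- enum F].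
  have cnt (X : finType) (x : X -> 'rV[K]_n) (l : 'rV[K]_n) :
      (forall e, x e != 0) -> l != 0 ->
      count_mem <<l>>%MS [seq <<x e>>%MS | e <- enum X] = #|[set e | (x e <= l)%MS]|.
    move=> x0 l0; rewrite count_map -sum1_count -sum1_card big_enum_cond /=.
    by apply: eq_bigl => e; rewrite inE gen.
  apply/allP => k; rewrite mem_cat => /orP[] /mapP[e _ ->];
    by apply/eqP; rewrite !cnt // card_multiples.
have cEF : #|E| = #|F| by rewrite !cardT -(size_map (fun e => <<v e>>%MS)) (perm_size pe) size_map.
have [F0|[f0 _]] := set_0Vmem [set: F].
  have noE (e : E) : False.
    have : (0 < #|E|)%N by apply/card_gt0P; exists e.
    by rewrite cEF -cardsT F0 cards0.
  exists (fun e => False_rect F (noE e)) => [|e]; last by case: (noE e).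
  by apply: inj_card_bij; [move=> e; case: (noE e) | rewrite cEF].
have e0 : E.
  have : (0 < #|E|)%N by rewrite cEF; apply/card_gt0P; exists f0.
  by move=> /card_gt0P/sigW[].
have /perm_iotaP := pe => /(_ 0)[Is pI sE].
have sI : size Is = #|F| by rewrite (perm_size pI) size_iota size_map -cardE.
(* The permutation [Is] of positions is transported to [E] and [F] through their enumerations. *)
pose g e := nth f0 (enum F) (nth 0%N Is (index e (enum E))).
have idx e : (index e (enum E) < size Is)%N.
  by rewrite sI -cEF cardE index_mem mem_enum.
have ltI e : (nth 0%N Is (index e (enum E)) < size (enum F))%N.
  have : nth 0%N Is (index e (enum E)) \in iota 0 (size [seq <<w e>>%MS | e <- enum F]).
    by rewrite -(perm_mem pI) mem_nth.
  by rewrite mem_iota size_map.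
exists g => [|e].
  apply: inj_card_bij; last by rewrite cEF.
  move=> x y /eqP; rewrite nth_uniq ?enum_uniq // nth_uniq //; last first.
    by rewrite (perm_uniq pI) iota_uniq.
  by move/eqP/(index_inj); rewrite ?mem_enum; apply.
have : <<v e>>%MS = <<w (g e)>>%MS.
  have := congr1 (fun s => nth 0 s (index e (enum E))) sE.
  rewrite (nth_map e0) ?index_mem ?mem_enum // nth_index ?mem_enum // => ->.
  by rewrite (nth_map 0%N) // (nth_map f0).
move/eqP; rewrite gen // => /(rV_submx_sym (v0 e))/sub_rVP[a wE].
exists a => //; apply: contraNneq (w0 (g e)) => a0; by rewrite wE a0 scale0r.
Qed.
End MacWilliams.

(** * From algebras to matroids *)

Section LocalAlgebra.
Variables (K : fieldType) (G : multigraph).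
Hypothesis hK : [pchar K] =i pred0.
Local Notation n := (nvertices G).
Local Notation B := (BF K G).
Implicit Types (p q : {mpoly K[n]}) (x y : B) (e : edge G).

Lemma BF_pi_eq p q : BF_pi p = BF_pi q :> B <-> JF (p - q).
Proof.
have -> : JF (p - q) = (p - q \in JF_ideal K G) by [].
rewrite Quotient.idealrBE; split; first by move=> E; apply/eqP.
by move/eqP.
Qed.

Lemma BF_pi_annih p q :
  BF_pi p = BF_pi q :> B <-> annih (map (edge_vec K (G := G)) (enum (edge G))) (p - q).
Proof. by rewrite BF_pi_eq JF_annih. Qed.

Lemma BF_piC c : BF_pi c%:MP = c *: (1 : B).
Proof. by rewrite /GRing.scale /= /BF_scale mulr1. Qed.

Lemma BF_pi_scale c p : BF_pi (c *: p) = c *: (BF_pi p : B).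
Proof. by rewrite -mul_mpolyC BF_piM BF_piC -scalerAl mul1r. Qed.

Lemma BF_piXn p k : BF_pi (p ^+ k) = (BF_pi p : B) ^+ k.
Proof. by elim: k => [|k IHk]; rewrite ?BF_pi1 // !exprS BF_piM IHk. Qed.

(** The augmentation of the local algebra; [eps_pi] shows independence of the representative. *)
Definition eps x : K := at0 (repr x).

Lemma repr_annih p :
  annih (map (edge_vec K (G := G)) (enum (edge G))) (repr (BF_pi p : B) - p).
Proof. by apply/BF_pi_annih; rewrite /BF_pi reprK. Qed.

Lemma eps_pi p : eps (BF_pi p) = at0 p.
Proof.
by have /annih_at0/eqP := repr_annih p; rewrite at0B subr_eq0 => /eqP.
Qed.

(** The edge as a point derivation, that is, as a functional on the cotangent space. *)
Definition tangent e x : K := at0 (ddir (edge_vec K e) (repr x)).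

Lemma tangent_pi e p : tangent e (BF_pi p) = at0 (ddir (edge_vec K e) p).
Proof.
have eE : edge_vec K e \in map (edge_vec K (G := G)) (enum (edge G)).
  by rewrite map_f // mem_enum.
have /eqP := annih_mem eE (repr_annih p).
by rewrite linearB at0B subr_eq0 => /eqP.
Qed.

Lemma eps_linear c x y : eps (c *: x + y) = c * eps x + eps y.
Proof.
have [[p ->] [q ->]] := (BF_piP x, BF_piP y).
by rewrite -BF_pi_scale -BF_piD !eps_pi at0D at0Z.
Qed.

Lemma epsD x y : eps (x + y) = eps x + eps y.
Proof. by have := eps_linear 1 x y; rewrite scale1r mul1r. Qed.

Lemma eps0 : eps 0 = 0.
Proof. by have := eps_linear (-1) 0 0; rewrite scaler0 addr0 mulN1r addNr. Qed.

Lemma epsZ c x : eps (c *: x) = c * eps x.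
Proof. by have := eps_linear c x 0; rewrite !addr0 eps0 addr0. Qed.

Lemma epsM x y : eps (x * y) = eps x * eps y.
Proof.
have [[p ->] [q ->]] := (BF_piP x, BF_piP y).
by rewrite -BF_piM !eps_pi at0M.
Qed.

Lemma eps1 : eps 1 = 1.
Proof. by rewrite -BF_pi1 eps_pi -mpolyC1 at0C. Qed.

Lemma eps_nilpotent x k : x ^+ k = 0 -> eps x = 0.
Proof.
have epsX : eps (x ^+ k) = eps x ^+ k.
  by elim: k => [|k IHk]; rewrite ?eps1 // !exprS epsM IHk.
move=> xk; move: epsX; rewrite xk eps0 => /esym/eqP.
by rewrite expf_eq0 => /andP[_ /eqP].
Qed.

Lemma tangent_linear e c x y : tangent e (c *: x + y) = c * tangent e x + tangent e y.
Proof.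
have [[p ->] [q ->]] := (BF_piP x, BF_piP y).
by rewrite -BF_pi_scale -BF_piD !tangent_pi linearP at0D at0Z.
Qed.

Lemma tangentM e x y : tangent e (x * y) = tangent e x * eps y + eps x * tangent e y.
Proof.
have [[p ->] [q ->]] := (BF_piP x, BF_piP y).
by rewrite -BF_piM !tangent_pi !eps_pi ddirM at0D !at0M.
Qed.

(** This is needed for arbitrary elements, because an ungraded isomorphism need not send linear
    forms to linear forms. *)
Lemma nilpotency_bound x k :
  x ^+ k = 0 -> (#|[set e | (tangent e x != 0)%R]| < k)%N.
Proof.
move=> xk; have x0 := eps_nilpotent xk.
have [p xE] := BF_piP x; rewrite xE eps_pi in x0.
have : annih (map (edge_vec K (G := G)) (enum (edge G))) (p ^+ k).
  rewrite -[p ^+ k]subr0; apply/BF_pi_annih; rewrite BF_piXn -xE xk.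
  by rewrite /BF_pi raddf0.
move/(annih_expr_lt hK x0); rewrite count_map -sum1_count -sum1_card.
rewrite big_enum_cond /=; congr (_ < _)%N; apply: eq_bigl => e.
by rewrite inE xE tangent_pi.
Qed.

Definition linear_elt (h : 'cV[K]_n) : B := BF_pi (\sum_i h i 0 *: 'X_i).

Lemma ddir_linear_form v (h : 'cV[K]_n) :
  ddir v (\sum_i h i 0 *: 'X_i) = ((v *m h) 0 0)%:MP.
Proof.
rewrite (linear_sum (ddir v)) mxE (raddf_sum (@mpolyC n K)); apply: eq_bigr => i _ /=.
by rewrite linearZ /= ddirX mulrC mpolyCM mul_mpolyC.
Qed.

Lemma tangent_linear_elt e h : tangent e (linear_elt h) = (edge_vec K e *m h) 0 0.
Proof. by rewrite tangent_pi ddir_linear_form at0C. Qed.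

(** With [nilpotency_bound] this makes the nilpotency index of a linear form exactly its weight plus
    one. *)
Lemma linear_elt_nilpotent h :
  linear_elt h ^+ #|[set e | tangent e (linear_elt h) != 0]|.+1 = 0.
Proof.
rewrite -BF_piXn -(_ : BF_pi 0 = 0 :> B); last by rewrite /BF_pi raddf0.
apply/BF_pi_annih; rewrite subr0 -[_ ^+ _]mul1r; apply: annih_expr_linear.
- by rewrite at0_sum big1 // => i _; rewrite at0Z at0X mulr0.
- by move=> v; eexists; apply: ddir_linear_form.
rewrite ltnS count_map -sum1_count -sum1_card big_enum_cond /=; apply: eq_leq.
apply: eq_bigl => e; rewrite inE tangent_linear_elt.
by rewrite ddir_linear_form mpolyC_eq0.
Qed.

(** By linearity and the Leibniz rule a point derivation is determined by its values on the
    coordinates. *)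
Lemma derivation_ddir (D : B -> K) :
    (forall c x y, D (c *: x + y) = c * D x + D y) ->
    (forall x y, D (x * y) = D x * eps y + eps x * D y) ->
  forall p, D (BF_pi p) = at0 (ddir (\row_i D (BF_pi 'X_i)) p).
Proof.
move=> DL DM.
have D1 : D 1 = 0.
  have /eqP := DM 1 1; rewrite eps1 !mulr1 mul1r -[X in X == _]addr0.
  by rewrite (can_eq (addKr _)) eq_sym => /eqP.
have D0 : D 0 = 0 by have := DL (-1) 0 0; rewrite scaler0 addr0 mulN1r addNr.
elim/mpoly_alg_ind => [c|i|p q IHp IHq|p q IHp IHq].
- have := DL c 1 0; rewrite addr0 D1 D0 mulr0 addr0 => Dc.
  by rewrite BF_piC ddirC Dc -mpolyC0 at0C.
- by rewrite ddirX at0C mxE.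
- by rewrite raddfD at0D -IHp -IHq BF_piD -[BF_pi p]scale1r DL mul1r scale1r.
- by rewrite BF_piM DM ddirM at0D !at0M -IHp -IHq !eps_pi.
Qed.
End LocalAlgebra.

(** * Cotangent maps of algebra isomorphisms *)

Section Isomorphism.
Variables (K : fieldType) (G H : multigraph).
Hypothesis hK : [pchar K] =i pred0.
Variable F : {lrmorphism BF K G -> BF K H}.

(** The coordinates are nilpotent, hence so are their images, and the augmentation kills
    nilpotents. *)
Lemma eps_iso x : eps (F x) = eps x.
Proof.
have [p ->] := BF_piP x; rewrite eps_pi //.
elim/mpoly_alg_ind: p => [c|i|p q IHp IHq|p q IHp IHq].
- by rewrite BF_piC linearZ rmorph1 at0C epsZ // eps1 // mulr1.
- rewrite at0X.
  pose h : 'cV[K]_(nvertices G) := delta_mx i 0.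
  have -> : BF_pi 'X_i = linear_elt h.
    rewrite /linear_elt (bigD1 i) //= mxE !eqxx scale1r big1 ?addr0 // => j ji.
    by rewrite mxE (negPf ji) scale0r.
  have := linear_elt_nilpotent hK h.
  by move/(congr1 F); rewrite rmorphXn raddf0 => /(eps_nilpotent hK).
- by rewrite BF_piD raddfD epsD // IHp IHq at0D.
- by rewrite BF_piM rmorphM epsM // IHp IHq at0M.
Qed.

(** The vector representing the derivation [tangent f] composed with [F]. *)
Definition pull_tangent f : 'rV[K]_(nvertices G) :=
  \row_i tangent f (F (BF_pi 'X_i)).

Lemma tangent_iso f p : tangent f (F (BF_pi p)) = at0 (ddir (pull_tangent f) p).
Proof.
apply: (@derivation_ddir _ _ hK (fun x => tangent f (F x))) => [c x y|x y].
  by rewrite linearP tangent_linear.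
by rewrite rmorphM tangentM // !eps_iso.
Qed.

Lemma tangent_linear_iso f h :
  tangent f (F (linear_elt h)) = (pull_tangent f *m h) 0 0.
Proof. by rewrite tangent_iso ddir_linear_form at0C. Qed.

Lemma weight_iso_le h :
  (#|[set f | (tangent f (F (linear_elt h)) != 0)%R]| <=
   #|[set e | (tangent e (linear_elt h) != 0)%R]|)%N.
Proof.
rewrite -ltnS; apply: nilpotency_bound => //.
by rewrite -rmorphXn linear_elt_nilpotent // raddf0.
Qed.
End Isomorphism.

Lemma linear_part_elt (K : fieldType) (G : multigraph) (hK : [pchar K] =i pred0)
    (p : {mpoly K[nvertices G]}) :
  exists h : 'cV[K]_(nvertices G), forall v, (v *m h) 0 0 = at0 (ddir v p).
Proof.
exists (\col_i at0 (p^`M(i))) => v; rewrite mxE /ddir at0_sum.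
by apply: eq_bigr => i _; rewrite mxE at0Z.
Qed.

Lemma sum_ddir (K : fieldType) n (E : finType) (A : {set E}) (b : E -> K)
    (v : E -> 'rV[K]_n) (p : {mpoly K[n]}) :
  \sum_(e in A) b e * at0 (ddir (v e) p) =
  at0 (ddir (\sum_(e in A) b e *: v e) p).
Proof.
rewrite /ddir at0_sum; under eq_bigr => e _ do rewrite at0_sum mulr_sumr.
rewrite exchange_big /=; apply: eq_bigr => i _.
rewrite at0Z summxE mulr_suml; apply: eq_bigr => e _.
by rewrite at0Z mxE mulrA.
Qed.

Section IsomorphismMatroid.
Variables (K : fieldType) (G H : multigraph).
Hypothesis hK : [pchar K] =i pred0.
Variables (F : {lrmorphism BF K G -> BF K H}) (F' : {lrmorphism BF K H -> BF K G}).
Hypotheses (FK : cancel F F') (F'K : cancel F' F).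

(** One inequality is [weight_iso_le] for [F]. For the other, the image of the form is replaced by
    its linear part [h'], which has the same tangents, and [weight_iso_le] is applied to [F']. *)
Lemma weight_iso (h : 'cV[K]_(nvertices G)) :
  #|[set e | edge_vec K e *m h != 0]| = #|[set f | pull_tangent F f *m h != 0]|.
Proof.
have mx11 (m : 'M[K]_1) : (m != 0) = (m 0 0 != 0).
  congr (~~ _); apply/eqP/eqP => [->|m0]; first by rewrite mxE.
  by apply/matrixP => i j; rewrite !ord1 m0 mxE.
transitivity #|[set e : edge G | tangent e (linear_elt h) != 0]|.
  by apply: eq_card => e; rewrite !inE mx11 tangent_linear_elt.
transitivity #|[set f : edge H | tangent f (F (linear_elt h)) != 0]|; last first.
  by apply: eq_card => e; rewrite !inE mx11 tangent_linear_iso.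
apply/eqP; rewrite eqn_leq weight_iso_le // andbT.
have [p pE] := BF_piP (F (linear_elt h)).
have [h' hP] := linear_part_elt hK p.
have -> : #|[set f | tangent f (F (linear_elt h)) != 0]| =
          #|[set f | tangent f (linear_elt h') != 0]|.
  by apply: eq_card => f; rewrite !inE pE tangent_pi // tangent_linear_elt // hP.
(* Tangents after [F'] depend only on the linear part, so [h'] may be traded back for
   [F (linear_elt h)], which [F'] returns to the original form. *)
have -> : #|[set e : edge G | tangent e (linear_elt h) != 0]| =
          #|[set e | tangent e (F' (linear_elt h')) != 0]|.
  apply: eq_card => e; rewrite !inE tangent_linear_iso // hP.
  by rewrite -tangent_iso // -pE FK.
exact: weight_iso_le.
Qed.

(** Both relations say that the combination of the derivations [tangent f] with coefficients [b]
    vanishes on all of [BF K H]. The first tests it on the images of the coordinates of [G], which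
    suffices since [F] is onto; the second tests it on the coordinates of [H]. *)
Lemma dependency_iso (b : edge H -> K) (A : {set edge H}) :
  \sum_(f in A) b f *: pull_tangent F f = 0 <->
  \sum_(f in A) b f *: edge_vec K f = 0.
Proof.
have coord1 x : \sum_(f in A) b f *: pull_tangent F f = 0 ->
    \sum_(f in A) b f * tangent f x = 0.
  move=> s0; rewrite -[x]F'K; have [p ->] := BF_piP (F' x).
  under eq_bigr => f _ do rewrite tangent_iso //.
  by rewrite sum_ddir s0 ddir_vec0 -mpolyC0 at0C.
have coord2 x : \sum_(f in A) b f *: edge_vec K f = 0 ->
    \sum_(f in A) b f * tangent f x = 0.
  move=> s0; have [p ->] := BF_piP x.
  under eq_bigr => f _ do rewrite tangent_pi //.
  by rewrite sum_ddir s0 ddir_vec0 -mpolyC0 at0C.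
split=> s0; apply/rowP => i; rewrite summxE [RHS]mxE.
  rewrite -[RHS](coord1 (BF_pi 'X_i) s0); apply: eq_bigr => f _.
  by rewrite mxE tangent_pi // ddirX at0C.
rewrite -[RHS](coord2 (F (BF_pi 'X_i)) s0); apply: eq_bigr => f _.
by rewrite mxE [pull_tangent _ _ _ _]mxE.
Qed.

Lemma independent_iso (A : {set edge H}) :
  independent (pull_tangent F) A <-> independent (edge_vec K (G := H)) A.
Proof. by split=> iA c /dependency_iso; apply: iA. Qed.
End IsomorphismMatroid.

Lemma independent_scale (K : fieldType) (n : nat) (E E' : finType) (f : E -> E')
    (v : E -> 'rV[K]_n) (w : E' -> 'rV[K]_n) (A : {set E}) :
    bijective f -> (forall e, exists2 a, a != 0 & w (f e) = a *: v e) ->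
  independent v A <-> independent w (f @: A).
Proof.
move=> [g fK gK] sc.
have /boolp.choice[a aP] : forall e, exists a, a != 0 /\ w (f e) = a *: v e.
  by move=> e; have [a] := sc e; exists a.
have a0 e := proj1 (aP e); have wE e := proj2 (aP e).
have sumE (c : E' -> K) :
    \sum_(e' in f @: A) c e' *: w e' = \sum_(e in A) (c (f e) * a e) *: v e.
  rewrite big_imset /=; last by move=> x y _ _; apply: (can_inj fK).
  by apply: eq_bigr => e _; rewrite wE scalerA.
split=> iA c; last first.
  move=> c0 e eA; have := iA (fun e' => c (g e') / a (g e')).
  rewrite sumE => /(_ _ (f e) (imset_f f eA)); rewrite fK => H.
  apply/eqP; suff: c e / a e == 0 by rewrite mulf_eq0 invr_eq0 (negPf (a0 e)) orbF.
  apply/eqP/H; rewrite -[RHS]c0; apply: eq_bigr => x _.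
  by rewrite fK mulfVK.
rewrite sumE => /iA H e' /imsetP[e eA ->]; have /eqP := H e eA.
by rewrite mulf_eq0 (negPf (a0 e)) orbF => /eqP.
Qed.

Theorem BF_isomorphic_matroid (K : fieldType) (G H : multigraph) :
    [pchar K] =i pred0 -> BF_isomorphic K G H ->
  matroid_isomorphic (graphical_matroid G) (graphical_matroid H).
Proof.
move=> hK [F [F0 FK F0K]].
pose F1 : {linear BF K H -> BF K G} := HB.pack F0
  (GRing.isLinear.Build _ _ _ _ F0 (can2_linear FK F0K)).
pose F' : {lrmorphism BF K H -> BF K G} := HB.pack F0 (GRing.Linear.class F1)
  (GRing.isMonoidMorphism.Build _ _ F0 (can2_monoid_morphism FK F0K)).
have F'K : cancel F' F by [].
have FK' : cancel F F' by [].
have w0 f : pull_tangent F f != 0.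
  apply: contraNneq (edge_vec_neq0 K f) => f0.
  have := proj1 (dependency_iso hK F'K (fun=> 1) [set f]).
  by rewrite !big_set1 f0 !scale1r => ->.
have [f fbij fP] := macwilliams hK (edge_vec_neq0 K (G := G)) w0 (weight_iso hK FK').
exists f => // A; rewrite /indep /= (forestP K) (forestP K).
rewrite -(independent_iso hK F'K); exact: independent_scale fbij fP.
Qed.

(** * Sign scaling *)

(** Row sums along an induced path have this shape: a row meets only the column before it and the
    column after it. *)
Lemma sum_two_terms (V : nmodType) (F : nat -> V) k j :
    (forall i, (i < k)%N -> i != j -> i.+1 != j -> F i = 0) ->
  \sum_(i < k) F i =
  (if (j < k)%N then F j else 0) + (if (0 < j <= k)%N then F j.-1 else 0).
Proof.
move=> F0.
rewrite -(big_ord1_eq +%R F j) -[X in _ + X](_ : \sum_(i < k | i.+1 == j) F i = _).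
  rewrite [X in _ = X + _]big_mkcond [X in _ = _ + X]big_mkcond -big_split /=.
  apply: eq_bigr => i _; have [ij|ij] := eqVneq (i : nat) j.
    by rewrite -ij gtn_eqF // addr0.
  by rewrite add0r; have [//|ij'] := eqVneq i.+1 j; apply: F0.
case: j {F0} => [|j] /=; first by rewrite big1.
by rewrite -(big_ord1_eq +%R F j); apply: eq_bigl.
Qed.

Section SignScaling.
Variables (K : fieldType) (R C : finType).
Implicit Types (A : R -> C -> K) (P : {set R}) (Q : {set C}).

Definition signed A := forall b e, A b e != 0 -> A b e * A b e = 1.

(** Linear dependence of the columns [Q] restricted to the rows [P]; when [P] and [Q] have equal
    size, the vanishing of a minor. *)
Definition dependent_on A P Q : Prop :=
  exists2 d : C -> K, exists2 e, e \in Q & d e != 0 &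
    forall b, b \in P -> \sum_(e in Q) d e * A b e = 0.

(** * Adjoining a column [e0]: signs along paths in the bipartite graph of the support *)

Section Path.
Variables (A A' : R -> C -> K) (Q0 : {set C}) (e0 : C).
Hypotheses (sA : signed A) (sA' : signed A').
Hypothesis dep : forall P Q, dependent_on A P Q <-> dependent_on A' P Q.
Hypothesis AA' : forall b e, e \in Q0 -> A' b e = A b e.
Hypothesis e0Q : e0 \notin Q0.

(** The hypothesis [dep] is applied to one-by-one submatrices. *)
Lemma signed_support b e : (A b e == 0) = (A' b e == 0).
Proof.
have key D : (D b e == 0) <-> dependent_on D [set b] [set e].
  split=> [/eqP D0|[d [f]]].
    exists (fun=> 1); first by exists e; rewrite ?inE ?eqxx ?oner_eq0.
    by move=> x; rewrite inE => /eqP ->; rewrite big_set1 D0 mulr0.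
  rewrite inE => /eqP -> de /(_ b); rewrite inE eqxx big_set1 => /(_ isT) /eqP.
  by rewrite mulf_eq0 (negPf de).
by apply/idP/idP => /key; [rewrite dep | rewrite -dep] => /key.
Qed.

(** A walk b_0, e_0, b_1, ..., e_(k-1), b_k alternating between rows and columns of [Q0]. *)
Definition row_path k (b : nat -> R) (e : nat -> C) :=
  forall i, (i < k)%N -> [/\ e i \in Q0, A (b i) (e i) != 0 & A (b i.+1) (e i) != 0].

Section InducedPath.
Variables (k : nat) (b : nat -> R) (e : nat -> C).
Hypothesis bP : row_path k.+1 b e.
Hypothesis induced : forall i j, (i < k.+1)%N -> (j <= k.+1)%N ->
  j != i -> j != i.+1 -> A (b j) (e i) = 0.
Hypothesis interior : forall i, (0 < i < k.+1)%N -> A (b i) e0 = 0.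

(** The relation forced along the path, normalised to 1 on the first column: each interior row
    determines the next coefficient. Multiplying by an entry divides by it, since its square is
    1. *)
Fixpoint coef i : K :=
  if i is j.+1 then - coef j * A (b j.+1) (e j) * A (b j.+1) (e j.+1) else 1.

Lemma coef_sq i : (i < k.+1)%N -> coef i * coef i = 1.
Proof.
elim: i => [|i IHi] ik /=; first by rewrite mulr1.
have [_ _ A1] := bP (ltnW ik); have [_ A2 _] := bP ik.
have {}A1 := sA A1; have {}A2 := sA A2; have {}IHi := IHi (ltnW ik).
transitivity ((coef i * coef i) * (A (b i.+1) (e i) * A (b i.+1) (e i)) *
   (A (b i.+1) (e i.+1) * A (b i.+1) (e i.+1))); first by ring.
by rewrite A1 A2 IHi !mul1r.
Qed.

Let Pset := [set b (val i) | i : 'I_k.+2].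
Let Qset := e0 |: [set e (val i) | i : 'I_k.+1].

Lemma path_col_inj : injective (fun i : 'I_k.+1 => e (val i)).
Proof.
have key i j : (i < k.+1)%N -> (j < k.+1)%N -> (i < j)%N -> e i != e j.
  move=> ik jk ij; apply/eqP => eE.
  have [_ _] := bP jk; rewrite -eE induced ?eqxx //; lia.
move=> i j eE; apply: val_inj => /=.
by have [ij|ij|//] := ltngtP i j; have := key _ _ (ltn_ord _) (ltn_ord _) ij;
  rewrite eE eqxx.
Qed.

Lemma path_row_sum (D : R -> C -> K) (d : C -> K) j : (j <= k.+1)%N ->
    (forall b f, f \in Q0 -> D b f = A b f) ->
  \sum_(f in Qset) d f * D (b j) f =
  d e0 * D (b j) e0 + ((if (j < k.+1)%N then d (e j) * A (b j) (e j) else 0)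
   + (if (0 < j)%N then d (e j.-1) * A (b j) (e j.-1) else 0)).
Proof.
move=> jk DA; rewrite big_setU1 /=; last first.
  apply: contra e0Q => /imsetP[i _ ->].
  by have [] := bP (ltn_ord i).
congr (_ + _); rewrite big_imset /=; last by move=> x y _ _; apply: path_col_inj.
transitivity (\sum_(i < k.+1) d (e i) * A (b j) (e i)).
  apply: eq_big => [//|i _].
  by rewrite DA //; have [] := bP (ltn_ord i).
rewrite (@sum_two_terms _ (fun i => d (e i) * A (b j) (e i)) _ j).
  by rewrite jk andbT.
move=> i ik ij ij'; rewrite induced ?mulr0 //; by rewrite eq_sym.
Qed.

Let x := A (b 0) (e 0).
Let y := coef k * A (b k.+1) (e k).

(** The submatrix is supported on a cycle closed up by [e0], so its determinant has at most two
    terms, and dependence means that they cancel. The interior rows are solved by [coef]; the two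
    end rows give the equation. *)
Lemma dependent_path (D : R -> C -> K) : signed D ->
    (forall b f, f \in Q0 -> D b f = A b f) ->
    (forall i, (0 < i < k.+1)%N -> D (b i) e0 = 0) ->
    D (b 0) e0 != 0 ->
  dependent_on D Pset Qset <-> D (b 0) e0 * y = D (b k.+1) e0 * x.
Proof.
move=> sD DA D0 Db0; set al := D (b 0) e0; set be := D (b k.+1) e0.
have alsq : al * al = 1 := sD _ _ Db0.
have xsq : x * x = 1 by have [_ /sA] := bP (ltn0Sn k).
have rowP (d : C -> K) : (forall c, c \in Pset -> \sum_(f in Qset) d f * D c f = 0) <->
   [/\ d e0 * al + d (e 0) * x = 0,
       d e0 * be + d (e k) * A (b k.+1) (e k) = 0
     & forall j, (j < k)%N ->
        d (e j.+1) * A (b j.+1) (e j.+1) + d (e j) * A (b j.+1) (e j) = 0].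
  split=> [dP|[r0 rk rj] c /imsetP[[j /= jk] _ ->]].
    have bP' j : (j < k.+2)%N -> b j \in Pset.
      by move=> jk; apply/imsetP; exists (Ordinal jk).
    split=> [||j jk].
    - have := dP _ (bP' 0 (ltn0Sn _)).
      by rewrite path_row_sum //= addr0.
    - have := dP _ (bP' k.+1 (ltnSn _)).
      by rewrite path_row_sum //= ltnn add0r.
    - have jk' : (j.+1 < k.+2)%N by lia.
      have := dP _ (bP' _ jk'); rewrite path_row_sum //=.
      rewrite D0 ?mulr0 ?add0r; last by lia.
      by rewrite ltnS jk.
  rewrite path_row_sum //; case: j jk => [|j] jk /=; first by rewrite addr0.
  rewrite ltnS; case: ltnP => jk'; first by rewrite D0 ?mulr0 ?add0r ?rj //; lia.
  have -> : j = k by lia.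
  by rewrite add0r.
split=> [[d [f fQ df] /rowP[r0 rk rj]]|E].
  have dj j : (j < k.+1)%N -> d (e j) = d (e 0) * coef j.
    elim: j => [|j IHj] jk; first by rewrite mulr1.
    have Asq : A (b j.+1) (e j.+1) * A (b j.+1) (e j.+1) = 1.
      by have [_ /sA] := bP jk.
    have := rj j jk; rewrite IHj; last by lia.
    move/eqP; rewrite addr_eq0 => /eqP H /=.
    by rewrite -[LHS]mulr1 -Asq mulrA H; ring.
  have de0 : d e0 * (al * y - be * x) = 0.
    move: r0 rk => /eqP; rewrite addr_eq0 => /eqP r0 /eqP.
    rewrite addr_eq0 dj // => /eqP rk.
    rewrite mulrBr !mulrA r0 rk /y; ring.
  have d0 : d e0 != 0.
    apply: contraNneq df => d0.
    have de : d (e 0) = 0.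
      move: r0; rewrite d0 mul0r add0r => /eqP; rewrite mulf_eq0 => /orP[/eqP //|/eqP x0].
      by move: xsq; rewrite x0 mul0r => /esym/eqP; rewrite oner_eq0.
    move: fQ; rewrite !inE => /orP[/eqP ->|/imsetP[[j jk] _ ->]]; first exact/eqP.
    by rewrite /= dj // de mul0r.
  move/eqP: de0; rewrite mulf_eq0 (negPf d0) /= subr_eq0 => /eqP //.
(* With coefficient 1 on the first path column, row [b 0] forces - x al on [e0], because [al] is its
   own inverse. *)
have [d dE] : exists d : C -> K, d e0 = - (x * al) /\ forall i, (i < k.+1)%N -> d (e i) = coef i.
  exists (fun f => if f == e0 then - (x * al) else
     \sum_(i < k.+1 | e i == f) coef i); rewrite eqxx; split=> // i ik.
  have [_ _ _] := bP ik.
  rewrite ifN; last by apply: contraNneq e0Q => <-; have [] := bP ik.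
  rewrite (big_pred1 (Ordinal ik)) // => j /=.
  apply/eqP/eqP => [ee|-> //].
  by apply: path_col_inj => /=.
case: dE => d0 dE.
exists d; first by exists e0; rewrite ?inE ?eqxx // d0 oppr_eq0 mulf_neq0 //;
  apply: contraTneq isT => x0; move: xsq; rewrite x0 mul0r => /esym/eqP; rewrite oner_eq0.
apply/rowP; split.
- rewrite d0 dE // mulNr -mulrA alsq mulr1 mul1r; exact: addNr.
- rewrite d0 dE // mulNr mulrC -/y; apply/eqP.
  rewrite addrC subr_eq0; apply/eqP; rewrite mulrA -E.
  by rewrite mulrAC alsq mul1r.
- move=> j jk; rewrite !dE; try lia.
  have Asq : A (b j.+1) (e j.+1) * A (b j.+1) (e j.+1) = 1.
    by have [_ /sA] := bP (jk : (j.+1 < k.+1)%N).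
  by rewrite /= -[X in X + _]mulrA Asq; ring.
Qed.

(** By [dep], the cancellation condition of [dependent_path] holds for [A] exactly when it holds for
    [A'], with the same [x] and [y]. All the quantities are signs, so the ratio of the two end
    entries of column [e0] is the same in both matrices. *)
Lemma induced_path_sign : A (b 0) e0 != 0 -> A (b k.+1) e0 != 0 ->
  A' (b 0) e0 * A (b 0) e0 = A' (b k.+1) e0 * A (b k.+1) e0.
Proof.
move=> A0 Ak.
have A0' : A' (b 0) e0 != 0 by rewrite -signed_support.
have Ak' : A' (b k.+1) e0 != 0 by rewrite -signed_support.
have int' i : (0 < i < k.+1)%N -> A' (b i) e0 = 0.
  by move=> /interior /eqP; rewrite signed_support => /eqP.
have D1 := dependent_path sA (fun _ _ _ => erefl) interior A0.
have D2 := dependent_path sA' AA' int' A0'.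
have iff : A (b 0) e0 * y = A (b k.+1) e0 * x <->
           A' (b 0) e0 * y = A' (b k.+1) e0 * x by rewrite -D1 -D2.
have xsq : x * x = 1 by have [_ /sA] := bP (ltn0Sn k).
have ysq : y * y = 1.
  have [_ _ /sA Asq] := bP (ltnSn k).
  by rewrite /y mulrACA coef_sq // Asq mulr1.
have := iff; move: (sA A0) (sA Ak) (sA' A0') (sA' Ak') xsq ysq.
move: (A (b 0) e0) (A (b k.+1) e0) (A' (b 0) e0) (A' (b k.+1) e0) x y.
move=> a c a' c' u v aa cc aa' cc' uu vv {}iff.
have pm (z : K) : z * z = 1 -> z = 1 \/ z = -1.
  move=> zz; have /eqP : (z - 1) * (z + 1) = 0 by rewrite -(subrr (1 : K)) -{3}zz; ring.
  by rewrite mulf_eq0 subr_eq0 addr_eq0 => /orP[]/eqP; [left|right].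
(* In characteristic two all signs coincide; otherwise the equivalence [iff] is checked on each
   choice of signs. *)
have [n1|n1] := eqVneq (1 : K) (-1).
  by move: (pm _ aa) (pm _ cc) (pm _ aa') (pm _ cc'); rewrite -n1 => - [] -> [] -> [] -> [] ->.
move: iff (pm _ aa) (pm _ cc) (pm _ aa') (pm _ cc') (pm _ uu) (pm _ vv).
by move=> iff [] ? [] ? [] ? [] ? [] ? [] ?; subst; move: iff;
  rewrite ?mulrNN ?mulrN1 ?mulN1r ?mulr1 ?mul1r ?opprK; (tauto || (move=> [h1 h2];
  first [by have /eqP := h1 erefl; rewrite ?(negPf n1) // eq_sym (negPf n1)
        |by have /eqP := h2 erefl; rewrite ?(negPf n1) // eq_sym (negPf n1)])).
Qed.
End InducedPath.

(** Strong induction on the length. A walk is split at an interior row meeting [e0], or shortened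
    along a chord; if neither is possible it is induced and [induced_path_sign] applies. *)
Lemma row_path_sign k (b : nat -> R) (e : nat -> C) :
    row_path k b e -> A (b 0) e0 != 0 -> A (b k) e0 != 0 ->
  A' (b 0) e0 * A (b 0) e0 = A' (b k) e0 * A (b k) e0.
Proof.
elim/ltn_ind: k b e => -[//|k] IHk b e bP Ab0 Abk.
have [int|] := boolP [forall i : 'I_k.+1, (0 < i)%N ==> (A (b i) e0 == 0)]; last first.
  case/forallPn => i; rewrite negb_imply => /andP[i0 Abi].
  have ik := ltn_ord i.
  transitivity (A' (b i) e0 * A (b i) e0).
    by apply: (IHk i) => // j ji; apply: bP; lia.
  have := IHk (k.+1 - i)%N _ (fun j => b (i + j)%N) (fun j => e (i + j)%N).
  rewrite /= addn0 subnKC; last by lia.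
  apply=> //; first by lia.
  by move=> j jk; rewrite addnS; apply: bP; lia.
have [ind|] := boolP [forall i : 'I_k.+1, forall j : 'I_k.+2,
    (j != i :> nat) ==> (j != i.+1 :> nat) ==> (A (b j) (e i) == 0)]; last first.
  case/forallPn => -[i /= ik] /forallPn[[j /= jk]].
  rewrite !negb_imply => /and3P[ji ji' Abj].
  have [_ Abi Abi'] := bP i ik; have [eQ _ _] := bP i ik.
  have [ij|ij] := ltnP i j.
    (* The chord leads from [e i] forward to [b j]: the walk jumps over the rows strictly between
       [b i] and [b j]. *)
    pose s := (j - i.+1)%N.
    have := IHk (k.+1 - s)%N _ (fun t => if (t <= i)%N then b t else b (t + s)%N)
      (fun t => if (t <= i)%N then e t else e (t + s)%N).
    rewrite /= ifN; last by rewrite /s; lia.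
    have -> : (k.+1 - s + s = k.+1)%N by rewrite /s; lia.
    apply=> //; first by rewrite /s; lia.
    move=> t tk; case: (ltngtP t i) => [ti|ti|->].
    - by apply: bP; lia.
    - by rewrite addSn; apply: bP; rewrite /s in tk *; lia.
    - by have -> : (i.+1 + s = j)%N by rewrite /s; lia.
  (* The chord leads from [b j] forward to [e i]: the walk leaves [b j] through [e i] and continues
     at [b i.+1]. *)
  pose s := (i - j)%N.
  have := IHk (k.+1 - s)%N _ (fun t => if (t <= j)%N then b t else b (t + s)%N)
      (fun t => if (t < j)%N then e t else e (t + s)%N).
  rewrite /= ifN; last by rewrite /s; lia.
  have -> : (k.+1 - s + s = k.+1)%N by rewrite /s; lia.
  apply=> //; first by rewrite /s; lia.
  move=> t tk; case: (ltngtP t j) => [tj|tj|->].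
  - by apply: bP; lia.
  - by rewrite addSn; apply: bP; rewrite /s in tk *; lia.
  - have -> : (j + s = i)%N by rewrite /s; lia.
    by have -> : (j.+1 + s = i.+1)%N by rewrite /s; lia.
apply: induced_path_sign bP _ _ Ab0 Abk => [i j ik jk ji ji'|i /andP[i0 ik]].
  move/forallP/(_ (Ordinal ik))/forallP/(_ (Ordinal (jk : (j < k.+2)%N))): ind.
  by rewrite /= ji ji' => /eqP.
by move/forallP/(_ (Ordinal ik)): int; rewrite /= i0 => /eqP.
Qed.

Definition row_adj (x y : R) := [exists f in Q0, (A x f != 0) && (A y f != 0)].

Lemma row_adj_sym : connect_sym row_adj.
Proof.
apply: sym_connect_sym => x y; apply: eq_existsb => f.
by rewrite [X in _ && X]andbC.
Qed.

Lemma connect_sign x y : connect row_adj x y -> A x e0 != 0 -> A y e0 != 0 ->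
  A' x e0 * A x e0 = A' y e0 * A y e0.
Proof.
case/connectP => p /(pathP x) pP -> Ax; rewrite (last_nth x) => Ay.
pose b i := nth x (x :: p) i.
(* The default [e0] can occur only beyond the end of the walk. *)
pose e i := odflt e0 [pick f in Q0 | (A (b i) f != 0) && (A (b i.+1) f != 0)].
apply: (@row_path_sign (size p) b e) => // i ip.
rewrite /e; case: pickP => [f /and3P[]//|none].
by have /existsP[f fP] := pP i ip; have := none f; rewrite fP.
Qed.

(** Each row is scaled by the sign that column [e0] requires somewhere in its connected component,
    which is well defined by [connect_sign]. A column of [Q0] meets a single component, and scaling
    it by the same sign keeps its entries unchanged. *)
Lemma extend_column : exists r c, [/\ forall b : R, r b * r b = 1 :> K,
  forall f : C, c f * c f = 1 :> K &
  forall b f, f \in e0 |: Q0 -> A' b f = r b * c f * A b f].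
Proof.
(* A component that misses the support of [e0] imposes no condition and gets the sign 1. *)
pose g b : K := if [pick x | connect row_adj b x && (A x e0 != 0)] is Some x
  then A' x e0 * A x e0 else 1.
have Tsq b : A b e0 != 0 -> (A' b e0 * A b e0) * (A' b e0 * A b e0) = 1.
  move=> Ab; rewrite mulrACA sA // sA' ?mulr1 //.
  by rewrite -signed_support.
have gsq b : g b * g b = 1.
  by rewrite /g; case: pickP => [x /andP[_ /Tsq]|] //; rewrite mulr1.
have gE b : A b e0 != 0 -> g b = A' b e0 * A b e0.
  move=> Ab; rewrite /g; case: pickP => [x /andP[bx Ax]|/(_ b)].
    by apply/esym/connect_sign.
  by rewrite connect0 Ab.
have gadj b b' f : f \in Q0 -> A b f != 0 -> A b' f != 0 -> g b = g b'.
  move=> fQ Ab Ab'; rewrite /g; congr (if _ is Some _ then _ else _).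
  apply: eq_pick => x; congr (_ && _).
  apply: same_connect; first exact: row_adj_sym.
  by apply/connect1/existsP; exists f; rewrite fQ Ab.
pose c f : K := if f == e0 then 1 else
  if [pick b | A b f != 0] is Some b then g b else 1.
exists g, c; split=> // [f|b f].
  rewrite /c; case: eqP => _; first by rewrite mulr1.
  by case: pickP => [x _|_]; rewrite ?gsq ?mulr1.
rewrite !inE /c; case: eqP => [-> _|_ /= fQ].
  rewrite mulr1; have [A0|An] := eqVneq (A b e0) 0.
    by rewrite A0 mulr0; apply/eqP; rewrite -signed_support A0.
  by rewrite gE // -mulrA sA // mulr1.
rewrite AA' //; have [->|An] := eqVneq (A b f) 0; first by rewrite mulr0.
case: pickP => [x Ax|/(_ b)]; last by rewrite An.
by rewrite (gadj x b f) // gsq mul1r.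
Qed.
End Path.

Lemma dependent_on_scale A (r : R -> K) (c : C -> K) P Q :
    (forall b, r b != 0) -> (forall f, c f != 0) ->
  dependent_on (fun b f => r b * c f * A b f) P Q <-> dependent_on A P Q.
Proof.
move=> r0 c0; split=> -[d [f fQ df] dP].
  exists (fun f => d f * c f); first by exists f => //; rewrite mulf_neq0.
  move=> b bP; apply: (mulfI (r0 b)); rewrite mulr0 -[RHS](dP b bP) mulr_sumr.
  by apply: eq_bigr => g _; ring.
exists (fun f => d f / c f); first by exists f; rewrite // mulf_neq0 ?invr_eq0.
move=> b bP; rewrite -[RHS](mulr0 (r b)) -[X in _ = _ * X](dP b bP) mulr_sumr.
by apply: eq_bigr => g _; field.
Qed.

(** Columns are treated one at a time: once [A] is rescaled to agree with [A'] on the earlier ones,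
    [extend_column] corrects the next while preserving them. *)
Theorem sign_scaling A A' : signed A -> signed A' ->
    (forall P Q, dependent_on A P Q <-> dependent_on A' P Q) ->
  exists r c, [/\ forall b : R, r b * r b = 1 :> K,
    forall f : C, c f * c f = 1 :> K &
    forall b f, A' b f = r b * c f * A b f].
Proof.
move=> sA sA' dep.
have sq0 (z : K) : z * z = 1 -> z != 0.
  move=> zz; apply: contraTneq isT => z0; move: zz; rewrite z0 mul0r => /esym/eqP.
  by rewrite oner_eq0.
suff /(_ setT)[r [c [r1 c1 rc]]] : forall Q, exists r c,
    [/\ forall b : R, r b * r b = 1 :> K, forall f : C, c f * c f = 1 :> K &
    forall b f, f \in Q -> A' b f = r b * c f * A b f].
  by exists r, c; split=> // b f; apply: rc.
move=> Q; move: {2}#|Q| (erefl #|Q|) => k; elim: k Q => [|k IHk] Q cQ.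
  exists (fun=> 1), (fun=> 1); split=> [b|f|b f]; rewrite ?mulr1 //.
  by move/eqP: cQ; rewrite cards_eq0 => /eqP ->; rewrite inE.
have [e0 e0Q] : exists e0, e0 \in Q by apply/card_gt0P; rewrite cQ.
have [|r [c [r1 c1 rc]]] := IHk (Q :\ e0).
  by move: cQ; rewrite (cardsD1 e0) e0Q => -[].
pose A1 b f := r b * c f * A b f.
have r0 b := sq0 _ (r1 b); have c0 f := sq0 _ (c1 f).
have sA1 : signed A1.
  move=> b f; rewrite /A1 !mulf_eq0 !negb_or => /andP[_ /sA AA].
  transitivity ((r b * r b) * (c f * c f) * (A b f * A b f)); first by ring.
  by rewrite r1 c1 AA !mulr1.
have [P Q1|b f fQ||r' [c' [r1' c1' rc']]] := @extend_column A1 A' (Q :\ e0) e0 sA1 sA'.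
- by rewrite -dep; apply: dependent_on_scale.
- exact: rc.
- by rewrite !inE eqxx.
exists (fun b => r' b * r b), (fun f => c' f * c f); split=> [b|f|b f fQ].
- by rewrite mulrACA r1' r1 mulr1.
- by rewrite mulrACA c1' c1 mulr1.
- by rewrite rc' ?setD1K // /A1; ring.
Qed.
End SignScaling.

(** * From matroids to algebras *)

Section LinearExtension.
Variables (K : fieldType) (E : finType) (n m : nat).
Variables (v : E -> 'rV[K]_n) (B : {set E}).

(** The matrix of the independent rows has a right inverse [W], and [W *m U] takes the prescribed
    values. *)
Lemma independent_extend (u : E -> 'rV[K]_m) : independent v B ->
  exists L : 'M[K]_(n, m), forall b, b \in B -> v b *m L = u b.
Proof.
move=> iB; pose V := \matrix_(i < #|B|) v (enum_val i).
pose U := \matrix_(i < #|B|) u (enum_val i).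
have /row_freeP[W VW] : row_free V.
  apply: inj_row_free => x xV; apply/rowP => i; rewrite [RHS]mxE.
  pose c e := \sum_(j | enum_val j == e) x 0 j.
  have cE j : c (enum_val j) = x 0 j.
    rewrite /c (big_pred1 j) // => k /=; exact: (inj_eq enum_val_inj).
  rewrite -cE; apply: (iB c); last exact: enum_valP.
  rewrite big_enum_val -[RHS]xV mulmx_sum_row; apply: eq_bigr => j _.
  by rewrite cE rowK.
exists (W *m U) => b bB.
have -> : v b = row (enum_rank_in bB b) V by rewrite rowK enum_rankK_in.
rewrite mulmxA -row_mul VW row1 -rowE rowK enum_rankK_in //.
Qed.
End LinearExtension.

(** * Uniqueness of signed representations *)

Section UniqueRepresentation.
Variables (K : fieldType) (E : finType).

Definition signed_relations n (v : E -> 'rV[K]_n) := forall A : {set E},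
  ~ independent v A -> exists2 a : E -> K, \sum_e a e *: v e = 0 &
  [/\ exists e, a e != 0, forall e, a e != 0 -> e \in A
    & forall e, a e != 0 -> a e * a e = 1].

Section Coordinates.
Variables (n : nat) (v : E -> 'rV[K]_n) (B : {set E}).
Hypothesis sv : signed_relations v.
Hypothesis iB : independent v B.
Hypothesis maxB : forall e, e \notin B -> ~ independent v (e |: B).

(** For [e] outside the basis, a signed relation on [e |: B] must involve [e]. Its coefficient there
    is its own inverse, so solving for [v e] keeps the coordinates signed. *)
Lemma signed_coordinates : exists A : E -> E -> K, [/\ signed A,
  forall b e, (b \notin B) || (e \in B) -> A b e = 0 &
  forall e, e \notin B -> v e = \sum_(b in B) A b e *: v b].
Proof.
have /boolp.choice[a aP] : forall e, exists a : E -> K, e \notin B ->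
    [/\ forall b, a b != 0 -> a b * a b = 1, a e != 0 &
    \sum_(f in e |: B) a f *: v f = 0].
  move=> e; have [eB|eB] := boolP (e \in B); first by exists (fun=> 0).
  have [a a0 [[x ax] supp sq]] := sv (maxB eB); exists a => _; split=> //.
    apply: contraNneq (ax) => ae; apply/eqP/(iB (c := a)).
      apply: etrans a0; rewrite [RHS](bigID (mem B)) /= [X in _ + X]big1 ?addr0 //.
      move=> f fB; have [->|af] := eqVneq (a f) 0; first by rewrite scale0r.
      have := supp f af; rewrite !inE (negPf fB) orbF => /eqP fe.
      by rewrite fe ae eqxx in af.
    have := supp x ax; rewrite !inE => /orP[/eqP xe|//].
    by rewrite xe ae eqxx in ax.
  apply: etrans a0; rewrite [RHS](bigID (mem (e |: B))) /= [X in _ + X]big1 ?addr0 //.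
  by move=> f; have [->|/supp ->//] := eqVneq (a f) 0; rewrite scale0r.
exists (fun b e => if (b \in B) && (e \notin B) then - (a e b * a e e) else 0).
split=> [b e|b e|e eB].
- case: ifP => [/andP[bB eB]|_]; last by rewrite eqxx.
  have [sq _ _] := aP e eB; rewrite oppr_eq0 mulf_eq0 negb_or => /andP[/sq s1 /sq s2].
  by rewrite mulrNN mulrACA s1 s2 mulr1.
- by case: (b \in B); case: (e \in B).
- have [sq ae rel] := aP e eB.
  move: rel; rewrite big_setU1 //= => /eqP; rewrite addr_eq0 => /eqP rel.
  rewrite -[v e]scale1r -(sq _ ae) -scalerA rel -sumrN scaler_sumr.
  apply: eq_bigr => b bB; rewrite bB eB /=.
  by rewrite scalerN scalerA scaleNr mulrC.
Qed.

Variable A : E -> E -> K.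
Hypothesis A0 : forall b e, (b \notin B) || (e \in B) -> A b e = 0.
Hypothesis vA : forall e, e \notin B -> v e = \sum_(b in B) A b e *: v b.

Lemma sum_coordinates (Q : {set E}) (d : E -> K) : [disjoint Q & B] ->
  \sum_(e in Q) d e *: v e = \sum_(b in B) (\sum_(e in Q) d e * A b e) *: v b.
Proof.
move=> dis; under [RHS]eq_bigr => b _ do rewrite scaler_suml.
rewrite exchange_big /=; apply: eq_bigr => e eQ.
rewrite {1}vA; last by rewrite (disjointFr dis).
by rewrite scaler_sumr; apply: eq_bigr => b _; rewrite scalerA.
Qed.

(** Adjoining the basis vectors outside [P] amounts to forgetting the coordinates outside [P].
    Dependence of submatrices of the coordinate matrix is thereby read off from the matroid. *)
Lemma dependent_on_matroid (P Q : {set E}) : [disjoint Q & B] ->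
  dependent_on A P Q <-> ~ independent v (Q :|: (B :\: P)).
Proof.
move=> dis.
have split_sum (c : E -> K) : \sum_(e in Q :|: (B :\: P)) c e *: v e =
    \sum_(b in B) (\sum_(e in Q) c e * A b e + (b \notin P)%:R * c b) *: v b.
  rewrite (bigID (mem Q)) /= (eq_bigl (fun e => e \in Q)) => [|e]; last first.
    by rewrite inE; case: (e \in Q); rewrite ?andbF.
  rewrite [X in _ + X](eq_bigl (fun e => e \in B :\: P)) => [|e]; last first.
    rewrite !inE; have := disjointFr dis (x := e).
    by case: (e \in Q) => [/(_ isT) ->|_]; rewrite ?andbF ?andbT.
  rewrite sum_coordinates //.
  under [RHS]eq_bigr => b _ do rewrite scalerDl.
  rewrite big_split; congr (_ + _).
  rewrite [LHS]big_mkcond [RHS]big_mkcond; apply: eq_bigr => b _.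
  rewrite inE; case: (b \in B); case: (b \in P) => //=;
    by rewrite ?mul0r ?scale0r ?mul1r.
split=> [[d [f fQ df] dP] ind|/existsNP[c]].
  (* On [B :\: P] the coefficients are chosen to cancel the coordinates that [P] does not
     control. *)
  pose c e := if e \in Q then d e else - \sum_(f in Q) d f * A e f.
  have cQ b : \sum_(e in Q) c e * A b e = \sum_(e in Q) d e * A b e.
    by apply: eq_bigr => e eQ; rewrite /c eQ.
  have := ind c; rewrite split_sum => /(_ _ f); rewrite inE fQ /c fQ => H.
  case/eqP: df; apply: H => //; rewrite big1 // => b bB.
  rewrite (_ : \sum_(e in Q) _ = \sum_(e in Q) d e * A b e) ?cQ //.
  rewrite (disjointFl dis bB); have [bP|_] := boolP (b \in P).
    by rewrite dP // mul0r addr0 scale0r.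
  by rewrite mul1r subrr scale0r.
move/not_implyP => [c0 /existsNP[e /not_implyP[eQ /eqP ce]]].
rewrite split_sum in c0.
have cb b : b \in B -> \sum_(e in Q) c e * A b e + (b \notin P)%:R * c b = 0.
  exact: (iB (c := fun b => _) c0).
exists c; last first.
  move=> b bP; have [bB|bB] := boolP (b \in B).
    by have := cb b bB; rewrite bP mul0r addr0.
  by rewrite big1 // => f _; rewrite A0 ?bB ?mulr0.
apply: contrapT => nex.
have cQ f : f \in Q -> c f = 0.
  by move=> fQ; apply/eqP; apply: contrapT => /negP cf; apply: nex; exists f.
case/eqP: ce; move: eQ; rewrite !inE => /orP[/cQ //|/andP[eP eB]].
have := cb e eB; rewrite big1 => [|f /cQ ->]; last by rewrite mul0r.
by rewrite add0r eP mul1r.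
Qed.
End Coordinates.

(** A common basis gives two coordinate matrices with the same dependent submatrices, so
    [sign_scaling] relates them. Scaling basis vectors by row signs defines [L] and [L'], and column
    signs appear on the remaining vectors. *)
Theorem unique_representation m n (v : E -> 'rV[K]_m) (w : E -> 'rV[K]_n) :
    signed_relations v -> signed_relations w ->
    (forall A, independent v A <-> independent w A) ->
  exists s : E -> K, exists L : 'M[K]_(m, n), exists L' : 'M[K]_(n, m),
  [/\ forall e, s e * s e = 1, forall e, v e *m L = s e *: w e
    & forall e, w e *m L' = s e *: v e].
Proof.
move=> sv sw vw.
have [B /maxsetP[/asboolP iB maxB]] : {B | maxset (fun A => `[< independent v A >]) B}.
  by apply: ex_maxset; exists set0; apply/asboolP => c _ e; rewrite inE.
have {}maxB e : e \notin B -> ~ independent v (e |: B).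
  move=> eB /asboolP /maxB /(_ (subsetUr _ _)) E'.
  by rewrite -E' setU11 in eB.
have iBw : independent w B by rewrite -vw.
have maxBw e : e \notin B -> ~ independent w (e |: B) by rewrite -vw; apply: maxB.
have [A [sA A0 vA]] := signed_coordinates sv iB maxB.
have [A' [sA' A0' wA]] := signed_coordinates sw iBw maxBw.
have dep (P Q : {set E}) : dependent_on A P Q <-> dependent_on A' P Q.
  have [dis|/pred0Pn[e /andP[/= eQ eB]]] := boolP [disjoint Q & B].
    rewrite (dependent_on_matroid iB A0 vA) // (dependent_on_matroid iBw A0' wA) //.
    by rewrite vw.
  (* A column indexed by a basis element is zero in both matrices, so every [Q] meeting [B] is
     dependent. *)
  have triv (D : E -> E -> K) : (forall b e, (b \notin B) || (e \in B) -> D b e = 0) ->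
      dependent_on D P Q.
    move=> D0; exists (fun f => (f == e)%:R); first by exists e; rewrite // eqxx oner_eq0.
    move=> b _; rewrite big1 // => f _; case: eqP => [->|_]; last by rewrite mul0r.
    by rewrite D0 ?mulr0 // eB orbT.
  by split=> _; apply: triv.
have [r [c [r1 c1 rc]]] := sign_scaling sA sA' dep.
have [L LP] := independent_extend (fun b => r b *: w b) iB.
have [L' LP'] := independent_extend (fun b => r b *: v b) iBw.
exists (fun e => if e \in B then r e else c e), L, L'; split=> e.
- by case: ifP.
- case: ifPn => [/LP //|eB]; rewrite vA // wA // mulmx_suml scaler_sumr.
  apply: eq_bigr => b bB; rewrite -scalemxAl LP // !scalerA rc; congr (_ *: _).
  by transitivity ((c e * c e) * (A b e * r b)); [rewrite c1 mul1r | ring].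
- case: ifPn => [/LP' //|eB]; rewrite wA // vA // mulmx_suml scaler_sumr.
  apply: eq_bigr => b bB; rewrite -scalemxAl LP' // !scalerA rc; congr (_ *: _).
  by transitivity ((r b * r b) * (c e * A b e)); [ring | rewrite r1 mul1r].
Qed.
End UniqueRepresentation.

Lemma edge_vec_signed_relations (K : fieldType) (G : multigraph) (E : finType)
    (f : E -> edge G) : bijective f ->
  signed_relations (fun e => edge_vec K (f e)).
Proof.
case=> g fK gK A nA.
have /(not_forest K)[a a0 [[e ae] supp sgn]] : ~ forest (f @: A).
  rewrite (forestP K) => iA; apply: nA => c c0 e eA.
  have := iA (fun x => c (g x)); rewrite big_imset /=; last first.
    by move=> x y _ _; apply: (can_inj fK).
  move=> /(_ _ (f e) (imset_f f eA)); rewrite fK; apply.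
  by rewrite -[RHS]c0; apply: eq_bigr => x _; rewrite fK.
exists (fun x => a (f x)).
  by rewrite -[RHS]a0 [RHS](reindex f) //; apply: onW_bij; exists g.
split=> [|x ax|x ax].
- by exists (g e); rewrite gK.
- by have /imsetP[y yA /(can_inj fK) ->] := supp _ ax.
- by case: (sgn (f x)) ax => ->; rewrite ?eqxx ?mulr1 ?mulrNN ?mulr1.
Qed.

(** * Algebra maps induced by linear substitutions *)

Section InducedMap.
Variables (K : fieldType) (G H : multigraph) (L : 'M[K]_(nvertices H, nvertices G)).
Hypothesis hK : [pchar K] =i pred0.
Hypothesis Lann : forall p : {mpoly K[nvertices G]},
  annih (map (edge_vec K (G := G)) (enum (edge G))) p ->
  annih (map (edge_vec K (G := H)) (enum (edge H))) (lsubst L p).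

Definition BF_lsubst (x : BF K G) : BF K H := BF_pi (lsubst L (repr x)).

Lemma BF_lsubst_pi p : BF_lsubst (BF_pi p) = BF_pi (lsubst L p).
Proof.
apply/BF_pi_annih => //; rewrite -raddfB; apply: Lann.
exact: repr_annih.
Qed.

Lemma BF_lsubst_linear : linear BF_lsubst.
Proof.
move=> c x y; have [[p ->] [q ->]] := (BF_piP x, BF_piP y).
by rewrite -BF_pi_scale -BF_piD !BF_lsubst_pi linearP BF_piD BF_pi_scale.
Qed.

Lemma BF_lsubst_monoid_morphism : monoid_morphism BF_lsubst.
Proof.
split=> [|x y]; first by rewrite -BF_pi1 BF_lsubst_pi rmorph1 BF_pi1.
have [[p ->] [q ->]] := (BF_piP x, BF_piP y).
by rewrite -BF_piM !BF_lsubst_pi rmorphM BF_piM.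
Qed.

Lemma BF_lsubst_homog d x : BF_homog d x -> BF_homog d (BF_lsubst x).
Proof.
case=> p dp ->; exists (lsubst L p); first exact: dhomog_lsubst.
exact: BF_lsubst_pi.
Qed.
End InducedMap.

(** The matrices are mutually inverse only on the given vectors, so the composite substitution is
    the identity only modulo the annihilator. *)
Lemma annih_lsubst_id (K : fieldType) m n (L : 'M[K]_(n, m)) (L' : 'M[K]_(m, n))
    (vs : seq 'rV[K]_n) p :
  (forall v, v \in vs -> v *m L *m L' = v) ->
  annih vs (lsubst L (lsubst L' p) - p).
Proof.
elim: vs p => [|v vs IHvs] p LL' /=; first by rewrite at0B !at0_lsubst subrr.
have {}IHvs q : annih vs (lsubst L (lsubst L' q) - q).
  by apply: IHvs => u uvs; apply: LL'; rewrite inE uvs orbT.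
by split; rewrite // linearB /= !ddir_lsubst LL' ?mem_head.
Qed.

Lemma annih_edge_lsubst (K : fieldType) (G H : multigraph)
    (L : 'M[K]_(nvertices G, nvertices H)) (f : edge G -> edge H) (s : edge G -> K) :
    bijective f -> (forall e, s e != 0) ->
    (forall e, edge_vec K e *m L = s e *: edge_vec K (f e)) ->
  forall p, annih (map (edge_vec K (G := H)) (enum (edge H))) p ->
    annih (map (edge_vec K (G := G)) (enum (edge G))) (lsubst L p).
Proof.
move=> fbij s0 LE p pH; rewrite annih_lsubst -map_comp.
rewrite -(annih_scale _ _ s0 LE).
have pe : perm_eq (map f (enum (edge G))) (enum (edge H)).
  apply: uniq_perm; [|exact: enum_uniq|].
    by rewrite (map_inj_uniq (bij_inj fbij)) enum_uniq.
  move=> x; rewrite mem_enum inE; case: fbij => g fK gK.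
  by rewrite -[x]gK map_f ?mem_enum.
rewrite (map_comp (edge_vec K (G := H)) f).
by rewrite (annih_perm p (perm_map (edge_vec K (G := H)) pe)).
Qed.

Theorem matroid_BF_graded_isomorphic (K : fieldType) (G H : multigraph) :
    [pchar K] =i pred0 ->
    matroid_isomorphic (graphical_matroid G) (graphical_matroid H) ->
  BF_graded_isomorphic K G H.
Proof.
move=> hK [f fbij fP].
have sG := @edge_vec_signed_relations K G _ id (Bijective (frefl _) (frefl _)).
have sH := @edge_vec_signed_relations K H _ f fbij.
have vw A : independent (edge_vec K (G := G)) A <->
            independent (fun e => edge_vec K (f e)) A.
  rewrite -(forestP K); have := fP A; rewrite /indep /= => ->.
  rewrite (forestP K); apply: iff_sym; apply: independent_scale fbij _ => e.
  by exists 1; rewrite ?oner_eq0 // scale1r.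
have [s [L [L' [s1 LP LP']]]] := unique_representation sG sH vw.
have s0 e : s e != 0.
  by apply: contraTneq isT => z; move: (s1 e); rewrite z mul0r => /esym/eqP; rewrite oner_eq0.
case: (fbij) => g fK gK.
have annL := annih_edge_lsubst fbij s0 LP.
have LP2 e : edge_vec K e *m L' = s (g e) *: edge_vec K (g e).
  by rewrite -{1}[e]gK LP'.
have annL' := @annih_edge_lsubst _ _ _ L' g (fun e => s (g e))
  (Bijective gK fK) (fun e => s0 (g e)) LP2.
(* Substitution is contravariant: [L'] takes vectors of [H] to vectors of [G], hence polynomials of
   [G] to polynomials of [H]. *)
pose T := BF_lsubst L'; pose T' := BF_lsubst L.
have TK : cancel T T'.
  move=> x; have [p ->] := BF_piP x; rewrite /T /T' !BF_lsubst_pi //.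
  apply/BF_pi_annih => //; apply: annih_lsubst_id => v /mapP[e _ ->].
  by rewrite LP -scalemxAl LP' scalerA s1 scale1r.
have T'K : cancel T' T.
  move=> x; have [p ->] := BF_piP x; rewrite /T /T' !BF_lsubst_pi //.
  apply/BF_pi_annih => //; apply: annih_lsubst_id => v /mapP[e _ ->].
  by rewrite LP2 -scalemxAl LP gK scalerA s1 scale1r.
pose T1 : {linear BF K G -> BF K H} := HB.pack T
  (GRing.isLinear.Build _ _ _ _ T (BF_lsubst_linear hK annL')).
pose F : {lrmorphism BF K G -> BF K H} := HB.pack T (GRing.Linear.class T1)
  (GRing.isMonoidMorphism.Build _ _ T (BF_lsubst_monoid_morphism hK annL')).
exists F => [|d x]; first by exists T'.
split; first exact: BF_lsubst_homog.
by move/(BF_lsubst_homog hK annL); rewrite -/T' -[F x]/(T x) TK.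
Qed.

Theorem mainTheorem1 (K : fieldType) (hK : [pchar K] =i pred0)
    (G1 G2 : multigraph) :
  (BF_graded_isomorphic K G1 G2 <->
     matroid_isomorphic (graphical_matroid G1) (graphical_matroid G2)) /\
  (BF_isomorphic K G1 G2 <->
     matroid_isomorphic (graphical_matroid G1) (graphical_matroid G2)).
Proof.
have weaken : BF_graded_isomorphic K G1 G2 -> BF_isomorphic K G1 G2.
  by case=> F bF _; exists F.
have to_matroid := @BF_isomorphic_matroid K G1 G2 hK.
have of_matroid := @matroid_BF_graded_isomorphic K G1 G2 hK.
split; split=> //.
- by move/weaken.
- by move/of_matroid.
Qed.
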